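(* Let $F=\mathbb{Q}(\zeta_9)$, $K=\mathbb{Q}(\zeta_9+\zeta_9^{-1})$, $\Lambda=\frac13(1-\zeta_9)(1-\zeta_9^{-1})\mathbb{Z}_F$, and let $C$ be a $\mathbb{Z}/3\mathbb{Z}$-code of length $n\ge1$ with $C\subset C^\perp$. Then $$\theta_C=W_C(\theta_0,\theta_1)$$ as functions on $\mathbb{H}^{\oplus3}$, where $W_C$, $\theta_C$ and $\theta_a$ are defined in the context.
   Context: $\zeta_9=\exp(2\pi\sqrt{-1}/9)$; $\mathbb{Z}_F$ is the ring of integers of $F$; $\mathbb{H}$ is the upper half plane; bar is complex conjugation. $\mathrm{Gal}(K/\mathbb{Q})=\{\sigma_1=\mathrm{id},\sigma_2,\sigma_3\}$. **The lattice.** $\Lambda$ carries the form $(x,y)\mapsto\mathrm{Tr}_{F/\mathbb{Q}}(x\bar y)$. It has $\mathbb{Z}$-basis $f_i=\frac13(1-\zeta_9)(1-\zeta_9^2)\zeta_9^{i-1}$ ($1\le i\le6$). Its dual $\Lambda^*=\{x\in F:\mathrm{Tr}_{F/\mathbb{Q}}(x\bar y)\in\mathbb{Z}\ \forall y\in\Lambda\}$ has the dual basis $f_i^*=\frac13(1-\zeta_9^4)\zeta_9^{i-3}$ for $1\le i\le3$ and $f_i^*=\frac13(1-\zeta_9^4)(\zeta_9^{i-3}+\zeta_9^{i-6})$ for $4\le i\le6$. **Codes.** A $\mathbb{Z}/3\mathbb{Z}$-code of length $n$ is a submodule $C$ of $(\mathbb{Z}/3\mathbb{Z})^{\oplus n}$,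 and $C^\perp=\{x:\sum x_iy_i=0\ \forall y\in C\}$. Define the additive map $\rho^{\oplus n}:(\Lambda^* )^{\oplus n}\to(\mathbb{Z}/3\mathbb{Z})^{\oplus n}$ by $$\Big(\sum_{j=1}^6x_{ij}f_j^*\Big)_{1\le i\le n}\mapsto\Big(\sum_{j=1}^3x_{ij}-\sum_{j=4}^6x_{ij}\bmod3\Big)_{1\le i\le n}\qquad(x_{ij}\in\mathbb{Z}),$$ and $\Gamma_C=(\rho^{\oplus n})^{-1}(C)\subset F^{\oplus n}$. The weight enumerator is $W_C(X_0,X_1)=\sum_{c\in C}X_0^{l_0(c)}X_1^{l_1(c)}$, where $l_0(c)$ is the number of zeros in $c$ and $l_1(c)$ is the number of coordinates of $c$ equal to $1$ or $2$. **Theta functions.** On $F^{\oplus n}$ put $v\cdot w=\sum_{i=1}^n(v_i\overline{w_i}+\overline{v_i}w_i)\in K$. For $z=(z_1,z_2,z_3)\in\mathbb{H}^{\oplus3}$ put $\mathrm{Tr}_{K/\mathbb{Q}}(zx^2)=\sum_{l=1}^3z_l\sigma_l(x\cdot x)$. Let $x_0=0$, $x_1=f_1^*$, $x_2=-f_1^*$. For $a=0,1,2$, $$\theta_a(z)=\sum_{x\in x_a+\Lambda}\exp(\pi\sqrt{-1}\,\mathrm{Tr}_{K/\mathbb{Q}}(zx^2)),\qquad\theta_C(z)=\sum_{x\in\Gamma_C}\exp(\pi\sqrt{-1}\,\mathrm{Tr}_{K/\mathbb{Q}}(zx^2)).$$ *)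

(* Defs.v *)
From HB Require Import structures.
From mathcomp Require Import all_boot all_order all_fingroup all_algebra all_field.
From mathcomp Require Import complex.
From mathcomp Require Import ring lra.
From mathcomp Require Import all_classical all_reals all_analysis.
From mathcomp.analysis.showcase Require summability.

Set Implicit Arguments.
Unset Strict Implicit.
Unset Printing Implicit Defensive.

Import Order.TTheory GRing.Theory Num.Theory.
Import numFieldNormedType.Exports.

Local Open Scope classical_set_scope.
Local Open Scope ring_scope.
Local Open Scope complex_scope.

Definition cexp (R : realType) (z : R[i]) : R[i] :=
  (expR (complex.Re z))%:C * (cos (complex.Im z) +i* sin (complex.Im z)).

(* Unconditional sum over the set [S]: the limit of the finite partial sums
   along the filter of finite subsets of [I] (the term is 0 outside [S]). *)
Definition csum (R : realType) (I : choiceType) (S : set I) (f : I -> R[i]) :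
    R[i] :=
  summability.sum (patch (fun=> 0) S f : I -> R[i]^o).

Definition zeta9 (R : realType) : R[i] := cexp (2 * (pi : R)%:C * 'i / 9).

(* [F] with the embedding [iota] in the complex numbers and [zeta : F] is
   Q(zeta_9): [iota] sends [zeta] to exp(2 pi i / 9), and [zeta] generates [F]
   over the rationals. *)
Definition is_Q_zeta9 (R : realType) (F : splittingFieldType rat)
    (iota : {rmorphism F -> R[i]}) (zeta : F) : Prop :=
  iota zeta = zeta9 R /\ <<1; zeta>>%VS = fullv.

Lemma cexpX (R : realType) (z : R[i]) n : cexp z ^+ n = cexp (z *+ n).
Proof.
have expD (x y : R[i]) : cexp (x + y) = cexp x * cexp y.
  case: x y => [a b] [c d]; rewrite /cexp /= expRD cosD sinD.
  by apply/eqP; rewrite eq_complex /=; apply/andP; split; apply/eqP; ring.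
elim: n => [|n IHn]; last by rewrite exprS IHn mulrS expD.
by rewrite expr0 mulr0n /cexp /= expR0 cos0 sin0 mul1r.
Qed.

Lemma zeta9_prim (R : realType) : 9.-primitive_root (zeta9 R).
Proof.
have E n : 2 * (pi : R)%:C * 'i / 9 *+ n = 0 +i* (2 * pi * n%:R / 9).
  rewrite -mulr_natr.
  have -> : (2 * (pi : R)%:C * 'i / 9) = 0 +i* (2 * pi / 9).
    apply: (mulIf (_ : 9 != 0 :> R[i])); first by rewrite pnatr_eq0.
    rewrite mulfVK ?pnatr_eq0 //.
    have -> : (9 : R[i]) = (9%:R)%:C by rewrite rmorph_nat.
    have -> : (2 : R[i]) = (2%:R)%:C by rewrite rmorph_nat.
    by apply/eqP; rewrite eq_complex /=; apply/andP; split; apply/eqP; field.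
  have -> : (n%:R : R[i]) = (n%:R)%:C by rewrite rmorph_nat.
  by apply/eqP; rewrite eq_complex /=; apply/andP; split; apply/eqP; field.
have X n : zeta9 R ^+ n = cos (2 * pi * n%:R / 9) +i* sin (2 * pi * n%:R / 9).
  by rewrite /zeta9 cexpX E /cexp /= expR0 mul1r.
have [z1 _]: zeta9 R ^+ 9 = 1 /\ True.
  split=> //; rewrite X mulfK ?pnatr_eq0 // mulrC -[pi]/(pi : R).
  by rewrite mulrC mulr_natl cos2pi sin2pi.
have /prim_order_exists[//|m pm mdvd] := z1.
suff: m != 1%N /\ m != 3%N by move: m mdvd pm {X} => [|[|[|[|[|[|[|[|[|[|m]]]]]]]]]] //= _ _ [].
have p3: 0 < pi :> R by exact: pi_gt0.
have key k : (0 < k < 4)%N -> zeta9 R ^+ k != 1.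
  move=> /andP[k0 k4]; rewrite X; apply/eqP=> -[_ /eqP]; apply/negP.
  rewrite gt_eqF // sin_gt0_pi //.
  have k0' : 1 <= k%:R :> R by rewrite ler1n.
  have k3 : k%:R <= 3%:R :> R by rewrite ler_nat.
  apply/andP; split; [rewrite divr_gt0 // !mulr_gt0 // ?ltr0n // (lt_le_trans ltr01)|rewrite ltr_pdivrMr //; nra].
by split; apply: contraTneq pm => ->; apply/negP=> /prim_expr_order /eqP; apply/negP; exact: key.
Qed.

(* Such an [F] exists, so quantifying over it is not vacuous. *)
Lemma Q_zeta9_exists (R : realType) :
  exists (F : splittingFieldType rat) (iota : {rmorphism F -> R[i]}) (zeta : F),
    is_Q_zeta9 iota zeta.
Proof.
set z := zeta9 R.
pose QC : {rmorphism rat -> R[i]} := ratr.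
have pz := zeta9_prim R.
pose P (m : nat) := `[< exists2 p : {poly rat}, p != 0 & root (map_poly QC p) z /\ size p = m >].
have exP : exists m, P m.
  exists (size ('X^9 - 1 : {poly rat})); apply/asboolP; exists ('X^9 - 1).
    by rewrite -size_poly_eq0 size_XnsubC.
  split=> //; rewrite rmorphB /= map_polyXn rmorph1 rootE !hornerE.
  by rewrite (prim_expr_order pz) subrr.
have [m /asboolP[p nz_p [pz0 sp]] minm] := ex_minnP exP.
have irr_p : irreducible_poly p.
  apply/(subfx_irreducibleP pz0 nz_p) => q qz0 nzq; rewrite sp; apply: minm.
  by apply/asboolP; exists q.
pose L := SubFieldExtType pz0 irr_p.
pose iota : {rmorphism L -> R[i]} := @subfx_inj _ _ QC z p.
pose zt : L := subfx_root QC z p.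
have iz : iota zt = z by exact: subfx_inj_root.
have gen : <<1; zt>>%VS = fullv.
  apply/vspaceP => x; rewrite memvf.
  have [q ->] := subfxEroot pz0 nz_p x.
  apply: rpred_horner; last exact: memv_adjoin.
  apply/polyOverP=> i; rewrite coef_map /= -[_%:A]/(q`_i *: 1).
  by apply: rpredZ; rewrite mem1v.
have pzt : 9.-primitive_root zt by rewrite -(fmorph_primitive_root iota) iz.
have spl : SplittingField.axiom L.
  exists ('X^9 - 1); first by rewrite rpredB ?rpredX ?polyOverX ?rpred1.
  exists [seq zt ^+ i | i <- index_iota 0 9].
    by rewrite big_map (factor_Xn_sub_1 pzt) eqpxx.
  apply/eqP; rewrite eqEsubv subvf -gen.
  apply: (subv_trans _ (subvv _)).
  apply/FadjoinP; split; first exact: subv_adjoin_seq.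
  by apply: seqv_sub_adjoin; apply/mapP; exists 1%N; rewrite ?expr1.
pose F : splittingFieldType rat := HB.pack L (FieldExt_isSplittingField.Build rat L spl).
by exists F, iota, zt.
Qed.
Definition Kfield (F : splittingFieldType rat) (zeta : F) : {subfield F} :=
  <<1; zeta + zeta^-1>>%AS.

(* The family [sigma] lists Gal(K/Q) without repetition, the identity first. *)
Definition enumerates_Gal (F : splittingFieldType rat) (K : {subfield F})
    (sigma : 'I_3 -> gal_of K) : Prop :=
  [/\ sigma ord0 = 1%g, injective sigma
    & [set sigma l | l : 'I_3]%SET = 'Gal(K / 1)%g].

Section Lattice.
Variables (R : realType) (F : splittingFieldType rat).
Variables (iota : {rmorphism F -> R[i]}) (zeta : F).

(* Complex conjugation on [F], transported along [iota]. *)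
Definition bar (x : F) : F := xget 0 [set y | iota y = (iota x)^*%C].

Definition TrFQ (x : F) : F := galTrace 1%AS {:F}%AS x.

Definition ZF : set F := [set x | integralOver (intr : int -> F) x].

Definition Lambda : set F :=
  [set 3^-1 * (1 - zeta) * (1 - zeta^-1) * a | a in ZF].

Definition Lambda_dual : set F :=
  [set x | forall y, Lambda y -> exists m : int, TrFQ (x * bar y) = m%:~R].

(* f_i^* for i = j + 1, the indices [j : 'I_6] starting at 0. *)
Definition fdual (j : 'I_6) : F :=
  let i : int := j.+1 in
  if (j < 3)%N then 3^-1 * (1 - zeta ^+ 4) * zeta ^ (i - 3)
  else 3^-1 * (1 - zeta ^+ 4) * (zeta ^ (i - 3) + zeta ^ (i - 6)).

(* The coefficient of f_j^* in [x].  The f_j^* form a Q-basis of [F], and the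
   rational coordinates of a point of the dual lattice are integers, which
   [numq] returns. *)
Definition fdual_coord (x : F) (j : 'I_6) : int :=
  numq (coord [tuple fdual j | j < 6] j x).

(* rho^{(+)n}; only its values on vectors with entries in the dual lattice
   are meaningful. *)
Definition rho n (v : 'rV[F]_n) : 'rV['Z_3]_n :=
  \row_i ((\sum_(j < 6 | (j < 3)%N) fdual_coord (v 0 i) j
           - \sum_(j < 6 | (3 <= j)%N) fdual_coord (v 0 i) j)%:~R).

Definition Gamma n (C : {set 'rV['Z_3]_n}) : set 'rV[F]_n :=
  [set v : 'rV[F]_n | (forall i, Lambda_dual (v 0 i)) /\ rho v \in C].

Definition dot n (v w : 'rV[F]_n) : F :=
  \sum_(i < n) (v 0 i * bar (w 0 i) + bar (v 0 i) * w 0 i).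

Section Theta.
Variable sigma : 'I_3 -> gal_of (Kfield zeta).

(* Tr_{K/Q}(z x^2), where x^2 stands for x . x. *)
Definition TrKQ n (z : 'I_3 -> R[i]) (x : 'rV[F]_n) : R[i] :=
  \sum_(l < 3) z l * iota (sigma l (dot x x)).

Definition theta_sum n (S : set 'rV[F]_n) (z : 'I_3 -> R[i]) : R[i] :=
  csum S (fun x => cexp ((pi : R)%:C * 'i * TrKQ z x)).

Definition coset_rep (a : 'I_3) : F :=
  match val a with 0%N => 0 | 1%N => fdual ord0 | _ => - fdual ord0 end.

(* The coset x_a + Lambda, with [F] identified with the row vectors of
   length 1. *)
Definition coset_Lambda (a : 'I_3) : set 'rV[F]_1 :=
  [set const_mx (coset_rep a + y) | y in Lambda].

Definition theta (a : 'I_3) (z : 'I_3 -> R[i]) : R[i] :=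
  theta_sum (coset_Lambda a) z.

Definition theta_code n (C : {set 'rV['Z_3]_n}) (z : 'I_3 -> R[i]) : R[i] :=
  theta_sum (Gamma C) z.

End Theta.
End Lattice.

Section Codes.
Variable n : nat.
Implicit Types (C : {set 'rV['Z_3]_n}) (c : 'rV['Z_3]_n).

Definition is_code C : Prop := GRing.submod_closed [in C].

Definition dual_code C : {set 'rV['Z_3]_n} :=
  [set x : 'rV['Z_3]_n | [forall y : 'rV['Z_3]_n in C, \sum_(i < n) x 0 i * y 0 i == 0]]%SET.

Definition l0 c : nat := #|[set i | c 0 i == 0]%SET|.
Definition l1 c : nat := #|[set i | (c 0 i == 1) || (c 0 i == 2)]%SET|.

Definition weight_enum C (A : comNzRingType) (X0 X1 : A) : A :=
  \sum_(c in C) X0 ^+ l0 c * X1 ^+ l1 c.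

End Codes.

(* Main.v *)
Require Import Defs.
From HB Require Import structures.
From mathcomp Require Import all_boot all_order all_fingroup all_algebra all_field.
From mathcomp Require Import complex finmap ring lra zify.
From mathcomp Require Import all_classical all_reals all_analysis.
From mathcomp.analysis.showcase Require Import summability.

(** The term of a theta series at a vector [v] is a product over the entries
    of [v], because [v . v] is a sum over the entries, and whether a vector of the
    dual lattice belongs to [Gamma_C] depends only on the residues of its entries
    under [rho]. Grouping the vectors of [Gamma_C] by their image in the code gives
      theta_C = sum over c in C of the product over i of T(c_i),
    where [T a] is the sum of the one-variable terms over the points of the dual
    lattice with residue [a]. As [T 2 = T 1] by the symmetry [x -> -x], the
    product is [T(0)^l0(c) T(1)^l1(c)]. Two facts turn this into a proof.

    Arithmetic: the points of the dual lattice with residue [a] form the coset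
    [x_a + Lambda] ([coset_LambdaP]). With [mu = (1 - zeta^4) / 3], the
    dual lattice is [mu Z[zeta]] ([dualP]); there [rho] sends [mu p(zeta)] to
    [p(1)] modulo 3 ([rho_entry_ev]), that is, it is reduction modulo the prime
    [1 - zeta] above 3; and [Lambda] is [mu (1 - zeta) Z[zeta]] ([LambdaP]).
    This rests on the equality of the ring of integers with [Z[zeta]] ([algintP])
    and on the Fourier inversion
      9 u = sum over j < 9 of Tr(u zeta^-j) zeta^j   ([fourier9]),
    which recovers an element from traces: it gives the inclusion of the dual
    lattice in [mu Z[zeta]], the inclusion of 9 times the ring of integers in
    [Z[zeta]], and the traces of the powers of [zeta].

    Analysis: all sums are limits along the finite subsets of the index set, so
    that the rearrangement requires absolute convergence. The integers
    [Tr(x lam zeta^-j)], where [Lambda] is [lam Z[zeta]], determine a point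
    [x] of the dual lattice, and they are bounded by a linear function of the
    values of [x . x] at the three real places, so the terms decay geometrically
    in these integers ([entry_term_decay]). Given this bound, the grouping is an
    identity between finite sums over the boxes [A^n], which exhaust the vectors
    as [A] grows ([csum_code]). *)

Set Implicit Arguments.
Unset Strict Implicit.
Unset Printing Implicit Defensive.

Import Order.TTheory GRing.Theory Num.Theory.
Import numFieldNormedType.Exports.

Local Open Scope ring_scope.
Local Open Scope complex_scope.

Local Existing Instance totally_filter.

(** * The ring Z[zeta] and the prime above 3 *)

Section PrimeAboveThree.
Variables (F : splittingFieldType rat) (zeta : F).
Hypothesis z9 : 9.-primitive_root zeta.

(** Transported to the algebraic complex numbers, where a rational algebraic integer
    is known to be an integer. *)
Lemma integral_rat_int (r : rat) :
  integralOver (intr : int -> F) r%:A -> r \is a Num.int.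
Proof.
move=> [p pmon pr].
have rp : root (map_poly (intr : int -> rat) p) r.
  rewrite -(fmorph_root (in_alg F)) -map_poly_comp.
  by rewrite (eq_map_poly (g := intr)) // => a /=; rewrite -[LHS]/(in_alg F _) rmorph_int.
have : (ratr r : algC) \in Aint.
  apply: (@root_monic_Aint (map_poly intr p)).
  - rewrite (_ : map_poly intr p = map_poly ratr (map_poly (intr : int -> rat) p)).
      by rewrite fmorph_root.
    rewrite -map_poly_comp; apply: eq_map_poly => a /=; by rewrite ratr_int.
  - exact: monic_map.
  - by apply/polyOverP => i; rewrite coef_map /= intr_int.
move=> /(Cint_rat_Aint (Crat_rat r)) /intrP[m em].
apply/intrP; exists m; apply: (fmorph_inj (ratr : rat -> algC)).
by rewrite /= em ratr_int.
Qed.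

Lemma phi_zeta : zeta ^+ 6 + zeta ^+ 3 + 1 = 0.
Proof.
have h : (zeta ^+ 3 - 1) * (zeta ^+ 6 + zeta ^+ 3 + 1) = 0.
  have := prim_expr_order z9 => e9.
  transitivity (zeta ^+ 9 - 1); first by ring.
  by rewrite e9 subrr.
move/eqP: h; rewrite mulf_eq0 subr_eq0 => /orP[|/eqP//].
by rewrite -(prim_order_dvd z9).
Qed.

Definition Phi9 : {poly int} := 'X^6 + 'X^3 + 1.

Lemma size_Phi9 : size Phi9 = 7%N.
Proof.
rewrite /Phi9 -addrA size_polyDl ?size_polyXn //.
by rewrite (leq_ltn_trans (size_polyD _ _)) // size_polyXn size_poly1.
Qed.

Lemma monic_Phi9 : Phi9 \is monic.
Proof.
rewrite monicE /Phi9 -addrA addrC lead_coefDr ?lead_coefXn //.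
by rewrite size_polyXn (leq_ltn_trans (size_polyD _ _)) // size_polyXn size_poly1.
Qed.

Definition eval_zeta (p : {poly int}) : F := (map_poly intr p).[zeta].

Local Notation ev := eval_zeta.

Lemma evD p q : ev (p + q) = ev p + ev q.
Proof. by rewrite /eval_zeta rmorphD hornerD. Qed.
Lemma evB p q : ev (p - q) = ev p - ev q.
Proof. by rewrite /eval_zeta rmorphB /= !hornerE. Qed.
Lemma evN p : ev (- p) = - ev p.
Proof. by rewrite /eval_zeta rmorphN /= !hornerE. Qed.
Lemma evM p q : ev (p * q) = ev p * ev q.
Proof. by rewrite /eval_zeta rmorphM hornerM. Qed.
Lemma evC m : ev m%:P = m%:~R.
Proof. by rewrite /eval_zeta map_polyC hornerC. Qed.
Lemma ev1 : ev 1 = 1.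
Proof. by rewrite -[1]/(1%:P) evC. Qed.
Lemma evXn k : ev 'X^k = zeta ^+ k.
Proof. by rewrite /eval_zeta map_polyXn hornerXn. Qed.
Lemma evX : ev 'X = zeta.
Proof. by rewrite /eval_zeta map_polyX hornerX. Qed.
Definition evE := (evD, evB, evN, evM, evC, ev1, evXn, evX).

Lemma ev_Phi9 : ev Phi9 = 0.
Proof. by rewrite /Phi9 !evE phi_zeta. Qed.

(** Since [Phi9.[1] = 3], the number [p.[1]] can be killed by a multiple of [Phi9];
    the remainder is then divisible by ['X - 1]. *)
Lemma split_Phi9 (p : {poly int}) m : p.[1] = 3 * m ->
  exists q, p = m%:P * Phi9 + q * ('X - 1).
Proof.
move=> p1; have : root (p - m%:P * Phi9) 1.
  rewrite /root /Phi9 !hornerE p1; apply/eqP; ring.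
move=> /factor_theorem[q eq]; exists q.
by rewrite -eq addrC subrK.
Qed.

Lemma ev_div_prime (p : {poly int}) m : p.[1] = 3 * m ->
  exists q, ev p = (1 - zeta) * ev q.
Proof.
move=> /split_Phi9[q ->]; exists (- q); rewrite evD evM ev_Phi9 !evE; ring.
Qed.

(** The prime [1 - zeta] is totally ramified over 3: its sixth power is 3 times an
    element of [Z[zeta]]; [v] comes from expanding the power and using
    [zeta^6 = - zeta^3 - 1]. *)
Lemma three_ramified : exists v : {poly int}, (1 - zeta) ^+ 6 = 3 * ev v.
Proof.
exists (- 2%:P * 'X + 5%:P * 'X^2 - 7%:P * 'X^3 + 5%:P * 'X^4 - 2%:P * 'X^5).
rewrite !evE; apply/eqP; rewrite -subr_eq0; apply/eqP.
transitivity (zeta ^+ 6 + zeta ^+ 3 + 1); last exact: phi_zeta.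
ring.
Qed.

Notation algint := (integralOver (intr : int -> F)).

Lemma algint_zeta : algint zeta.
Proof.
exists ('X^9 - 1); first exact: monicXnsubC.
rewrite rmorphB /= map_polyXn rmorph1 rootE !hornerE.
by rewrite (prim_expr_order z9) subrr.
Qed.

Lemma algintX x k : algint x -> algint (x ^+ k).
Proof.
move=> hx; elim: k => [|k IH]; first exact: integral1.
by rewrite exprS; apply: integral_mul.
Qed.

Lemma algint_sum (I : Type) (r : seq I) (P : pred I) (f : I -> F) :
  (forall i, P i -> algint (f i)) -> algint (\sum_(i <- r | P i) f i).
Proof.
move=> h; apply: (big_ind (fun x => algint x)) => //.
  exact: mxpoly.integral0.
exact: integral_add.
Qed.

Lemma algint_ev p : algint (ev p).
Proof.
rewrite /eval_zeta horner_coef; apply: algint_sum => i _.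
rewrite coef_map; apply: integral_mul; first exact: integral_id.
exact: algintX algint_zeta.
Qed.

(** Modulo [1 - zeta], [p(zeta)] is the integer [p.[1]], so [1 - zeta] divides [p.[1]]
    among the algebraic integers; its sixth power is then 3 times an algebraic
    integer which is rational. *)
Lemma at1_div3 p y : algint y -> ev p = (1 - zeta) * y -> (3 %| p.[1])%Z.
Proof.
move=> hy epy.
have [q hq] : exists q, p - p.[1]%:P = q * ('X - 1).
  by apply/factor_theorem; rewrite /root !hornerE subrr.
have e1 : p.[1]%:~R = (1 - zeta) * (y + ev q) :> F.
  rewrite -[LHS]evC -[p.[1]%:P](subKr p) hq evB epy !evE; ring.
have iyq : algint (y + ev q) by apply: integral_add => //; exact: algint_ev.
have [v hv] := three_ramified.
have : ((p.[1] ^+ 6)%:~R / 3%:~R : rat) \is a Num.int.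
  apply: integral_rat_int.
  have -> : ((p.[1] ^+ 6)%:~R / 3%:~R : rat)%:A = ev v * (y + ev q) ^+ 6.
    rewrite -[LHS]/(in_alg F _) fmorph_div !rmorph_int.
    rewrite rmorphXn /= e1 exprMn hv.
    rewrite mulrAC [3 * _]mulrC mulfK //.
    by rewrite -[3](rmorph_nat (in_alg F)) fmorph_eq0.
  apply: integral_mul; first exact: algint_ev.
  exact: algintX.
move=> /intrP[m /(canRL (divfK _)) h].
have {}h : p.[1] ^+ 6 = m * 3.
  by apply: (@intr_inj rat); rewrite h // rmorphM.
have : (3 %| p.[1] ^+ 6)%Z by rewrite h dvdz_mull.
by rewrite !dvdzE abszX Euclid_dvdX // => /andP[].
Qed.

End PrimeAboveThree.

(** * Rational coordinates *)

Section IntegersTrace.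
Variables (F : splittingFieldType rat) (zeta : F).
Hypothesis z9 : 9.-primitive_root zeta.
Hypothesis zgen : <<1; zeta>>%VS = fullv.
Notation algint := (integralOver (intr : int -> F)).
Notation ev := (eval_zeta zeta).

(** Evaluation at [zeta] with rational coefficients, the counterpart of [eval_zeta]. *)
Definition evq (q : {poly rat}) : F := (map_poly (in_alg F) q).[zeta].

Lemma evq_span x : exists2 q : {poly rat}, (size q <= 6)%N & x = evq q.
Proof.
have : x \in <<1; zeta>>%VS by rewrite zgen memvf.
case/Fadjoin_polyP => p p1 ->.
have [q eq] : exists q, p = map_poly (in_alg F) q.
  exists (\poly_(i < size p) projT1 (sig_eqW (vlineP _ _ (polyOverP p1 i)))).
  apply/polyP => i; rewrite coef_map coef_poly /=.
  case: ltnP => hi; last by rewrite scale0r nth_default.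
  by case: sig_eqW => k /= ->.
pose Phi := map_poly (intr : int -> rat) Phi9.
have sPhi : size Phi = 7%N.
  by rewrite size_map_inj_poly ?mulr0z ?size_Phi9 //; exact: intr_inj.
exists (q %% Phi); first by rewrite -ltnS -sPhi ltn_modp -size_poly_eq0 sPhi.
rewrite eq /evq {1}(divp_eq q Phi) rmorphD rmorphM /= !hornerE.
rewrite -map_poly_comp (eq_map_poly (g := intr)); last first.
  by move=> a /=; rewrite -[LHS]/(in_alg F _) rmorph_int.
by have /= := ev_Phi9 z9; rewrite /eval_zeta => ->; rewrite mulr0 add0r.
Qed.

Lemma rmorph_zeta_ext (L : unitRingType) (f g : {rmorphism F -> L}) :
  f zeta = g zeta -> f =1 g.
Proof.
move=> efg x; have [q _ ->] := evq_span x.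
rewrite /evq !horner_coef !rmorph_sum; apply: eq_bigr => i _ /=.
rewrite coef_map /= -!scalerAl !mul1r.
by rewrite (rmorphZ_num f) (rmorphZ_num g) !rmorphXn /= efg.
Qed.

(** These are the coefficients of [Phi9] at ['X + 1], where Eisenstein's criterion
    applies at 3. *)
Lemma irreducible_Phi9_shift : irreducible_poly (Poly [:: 3; 9; 18; 21; 15; 6; 1] : {poly int}).
Proof.
apply: (@eisenstein_crit 3); rewrite ?lead_coefE ?(@PolyK _ 0) //.
by move=> [|[|[|[|[|[|i]]]]]].
Qed.

(** The powers [1, ..., zeta^5] are free over the rationals: a relation of size at most
    6 would share the root [zeta - 1], after the shift by 1, with an irreducible
    polynomial of degree 6. *)
Lemma evq_inj0 (q : {poly rat}) : (size q <= 6)%N -> evq q = 0 -> q = 0.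
Proof.
move=> sq q0.
pose P : {poly rat} := map_poly intr (Poly [:: 3; 9; 18; 21; 15; 6; 1] : {poly int}).
have sP : size P = 7%N.
  by rewrite size_map_inj_poly ?mulr0z ?(@PolyK _ 0) //; exact: intr_inj.
have irrP : irreducible_poly P by apply/irreducible_rat_int/irreducible_Phi9_shift.
pose q' := q \Po ('X + 1).
have sq' : size q' = size q by rewrite size_comp_poly2 // size_XaddC.
have rq : root (map_poly (in_alg F) q') (zeta - 1).
  rewrite rootE map_comp_poly horner_comp rmorphD /= map_polyX rmorph1.
  by rewrite !hornerE subrK; apply/eqP.
have rP : root (map_poly (in_alg F) P) (zeta - 1).
  rewrite rootE /P -map_poly_comp (eq_map_poly (g := intr)); last first.
    by move=> a /=; rewrite -[LHS]/(in_alg F _) rmorph_int.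
  rewrite map_Poly_id0 ?mulr0z // horner_Poly /=; apply/eqP.
  rewrite -[RHS](phi_zeta z9); ring.
have rg : root (map_poly (in_alg F) (gcdp P q')) (zeta - 1).
  by rewrite gcdp_map root_gcd rP rq.
have sg : size (gcdp P q') != 1%N.
  apply/negP => /size_poly1P[c c0 ec]; move: rg.
  by rewrite ec map_polyC rootC fmorph_eq0; apply/negP.
have /andP[_ Pq] := irrP.2 _ sg (dvdp_gcdl _ _).
have {}Pq : P %| q' by apply: dvdp_trans Pq (dvdp_gcdr _ _).
apply/eqP; rewrite -size_poly_eq0 -sq' size_poly_eq0; apply/negPn/negP => n0.
by have := dvdp_leq n0 Pq; rewrite sP sq' ltnNge sq.
Qed.

(** * The trace of Q(zeta_9) *)

Lemma galois1F : galois 1%AS {:F}%AS.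
Proof.
apply/and3P; split; [exact: sub1v | | exact: normalFieldf].
apply/separableP => x _; apply: pcharf0_separable => p.
by rewrite (pchar_lalg F) pchar_num.
Qed.

Lemma gal_zeta_id (s : gal_of {:F}) : s zeta = zeta -> s = 1%g.
Proof.
move=> sz; apply/eqP/gal_eqP => x _; rewrite gal_id.
exact: (@rmorph_zeta_ext _ s idfun).
Qed.

Lemma TrFQ_rat (u : F) : exists r : rat, TrFQ u = r%:A.
Proof.
have := mem_galTrace galois1F (memvf u).
by move/vlineP => [k ek]; exists k.
Qed.

Lemma TrFQZ (r : rat) (u : F) : TrFQ (r *: u) = r *: TrFQ u.
Proof. by rewrite /TrFQ /galTrace scaler_sumr; apply: eq_bigr => s _; rewrite linearZ. Qed.

Lemma TrFQM (r : rat) (u : F) : TrFQ (r%:A * u) = r%:A * TrFQ u.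
Proof. by rewrite -!scalerAl !mul1r TrFQZ. Qed.

Lemma TrFQD (u v : F) : TrFQ (u + v) = TrFQ u + TrFQ v.
Proof. exact: raddfD. Qed.

Lemma TrFQ_sum (I : Type) (r : seq I) (P : pred I) (f : I -> F) :
  TrFQ (\sum_(i <- r | P i) f i) = \sum_(i <- r | P i) TrFQ (f i).
Proof. exact: raddf_sum. Qed.

(** The conjugates of an algebraic integer are algebraic integers, hence so is the
    trace, which is rational. *)
Lemma TrFQ_int (u : F) : algint u -> exists m : int, TrFQ u = m%:~R.
Proof.
move=> hu; have [r er] := TrFQ_rat u.
have : algint r%:A.
  rewrite -er; apply: algint_sum => s _; case: hu => p pm pu; exists p => //.
  rewrite -(fmorph_root s) -map_poly_comp in pu.
  rewrite (eq_map_poly (g := intr)) // in pu => a /=; exact: rmorph_int.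
move=> /integral_rat_int/intrP[m em]; exists m.
by rewrite er em -[LHS]/(in_alg F _) rmorph_int.
Qed.

(** Fourier inversion over the ninth roots of unity. Exchanging the sums over [j] and
    over the Galois group leaves, for each [s], the sum over [j] of
    [(zeta / s zeta)^j]; this is 0 unless [s] fixes [zeta], that is, unless [s = 1]. *)
Lemma fourier9 u : 9 * u = \sum_(j < 9) TrFQ (u * zeta ^- j) * zeta ^+ j.
Proof.
have zn0 : zeta != 0 by rewrite (prim_root_eq0 z9).
transitivity (\sum_(s in 'Gal({:F} / 1)%g) s u * \sum_(j < 9) (zeta / s zeta) ^+ j).
  rewrite (bigD1 1%g) ?group1 //= [X in _ = _ + X]big1 => [|s /andP[_ s1]].
    rewrite addr0 gal_id gal_id divff // (eq_bigr (fun=> 1)) => [|j _]; last exact: expr1n.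
    by rewrite sumr_const card_ord mulrC.
  set y := zeta / s zeta.
  have y1 : y != 1.
    apply: contraNneq s1 => y1; apply/eqP/gal_zeta_id.
    have sz0 : s zeta != 0 by rewrite fmorph_eq0.
    by move: y1; rewrite /y => /(canRL (divfK sz0)); rewrite mul1r.
  have : (y - 1) * (\sum_(j < 9) y ^+ j) = 0.
    by rewrite -subrX1 expr_div_n -rmorphXn /= prim_expr_order // rmorph1 divr1 subrr.
  by move/eqP; rewrite mulf_eq0 subr_eq0 (negPf y1) /= => /eqP->; rewrite mulr0.
under eq_bigr do rewrite mulr_sumr.
rewrite exchange_big /=; apply: eq_bigr => j _.
rewrite /TrFQ /galTrace mulr_suml; apply: eq_bigr => s _.
by rewrite rmorphM fmorphV rmorphXn exprMn -exprVn mulrA mulrAC.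
Qed.

Lemma algint_fourier9 u : algint u -> exists p, 9 * u = ev p.
Proof.
move=> hu.
have h j : exists m : int, TrFQ (u * zeta ^- j) = m%:~R.
  apply: TrFQ_int; apply: integral_mul => //.
  have -> : zeta ^- j = zeta ^+ (8 * j).
    have zn0 : zeta != 0 by rewrite (prim_root_eq0 z9).
    apply: (mulfI (expf_neq0 j zn0)); rewrite divff ?expf_neq0 // -exprD.
    by rewrite -mulSn exprM (prim_expr_order z9) expr1n.
  exact: algintX (algint_zeta z9).
have /fin_all_exists[m em] : forall j : 'I_9, exists m : int, TrFQ (u * zeta ^- j) = m%:~R.
  by move=> j; exact: h.
exists (\sum_(j < 9) (m j)%:P * 'X^j); rewrite fourier9.
rewrite /eval_zeta rmorph_sum horner_sum; apply: eq_bigr => j _.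
by rewrite -/(ev _) !evE em.
Qed.

(** * The ring of integers *)

(** If [(1 - zeta) y] lies in [Z[zeta]] with [y] integral, its polynomial takes at 1 a
    value divisible by 3 ([at1_div3]), so that [1 - zeta] can be divided out
    inside [Z[zeta]] ([ev_div_prime]). *)
Lemma algint_descent k y : algint y ->
  (exists p, (1 - zeta) ^+ k * y = ev p) -> exists p, y = ev p.
Proof.
move=> hy; elim: k => [|k IH] [p ep]; first by exists p; rewrite -ep mul1r.
have hy' : algint ((1 - zeta) ^+ k * y).
  have [q ->] : exists q, (1 - zeta) ^+ k = ev q.
    exists ((1 - 'X) ^+ k); elim: k {IH ep} => [|k IH]; first by rewrite !expr0 ev1.
    by rewrite !exprS evM -IH !evE.
  by apply: integral_mul => //; exact: algint_ev.
have ep' : ev p = (1 - zeta) * ((1 - zeta) ^+ k * y) by rewrite mulrA -exprS ep.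
have /dvdzP[m hm] := at1_div3 z9 hy' ep'.
rewrite mulrC in hm; have [q eq] := ev_div_prime z9 hm.
apply: IH; exists q; apply: (@mulfI _ (1 - zeta)); last by rewrite -ep' -eq.
rewrite subr_eq0 eq_sym -[zeta]expr1 -(prim_order_dvd z9) //.
Qed.

(** Nine times an integer of the field lies in [Z[zeta]] by Fourier inversion, and 9
    divides [(1 - zeta)^12]; the descent removes that power. *)
Lemma algintP y : algint y <-> exists p, y = ev p.
Proof.
split=> [hy|[p ->]]; last exact: algint_ev.
(* [(1 - zeta)^12 = 9 v(zeta)^2] by [three_ramified]. *)
apply: (@algint_descent 12) => //.
have [p ep] := algint_fourier9 hy; have [v ev6] := three_ramified z9.
exists (v ^+ 2 * p); rewrite !evE -ep (exprM _ 6 2) ev6; ring.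
Qed.

End IntegersTrace.

(** * Complex conjugation on Q(zeta_9) *)

Section Conjugation.
Variables (R : realType) (F : splittingFieldType rat).
Variables (iota : {rmorphism F -> R[i]}) (zeta : F).
Hypothesis hF : is_Q_zeta9 iota zeta.
Notation algint := (integralOver (intr : int -> F)).
Notation ev := (eval_zeta zeta).

Lemma zeta_prim : 9.-primitive_root zeta.
Proof. by rewrite -(fmorph_primitive_root iota) hF.1; exact: zeta9_prim. Qed.
Let z9 := zeta_prim.
Let zgen : <<1; zeta>>%VS = fullv := hF.2.

Lemma zeta_neq0 : zeta != 0.
Proof. by rewrite (prim_root_eq0 z9). Qed.

Lemma conj_iota_zeta : ((iota zeta)^*)%C = (iota zeta)^-1.
Proof.
have z1 : `|iota zeta| = 1.
  apply/eqP; rewrite -(@pexpr_eq1 _ _ 9) // -normrX -rmorphXn /=.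
  by rewrite (prim_expr_order z9) rmorph1 normr1.
by rewrite invc_norm z1 expr1n invr1 mul1r.
Qed.

(** The element with conjugate image is obtained by evaluating at [zeta^-1] the rational
    polynomial that gives [x] at [zeta]. *)
Lemma iota_bar x : iota (bar iota x) = ((iota x)^*)%C.
Proof.
rewrite /bar; case: xgetP => [y _ -> //|].
have [q _ ->] := evq_span z9 zgen x.
move=> /(_ (map_poly (in_alg F) q).[zeta^-1]) /= []; rewrite /evq !horner_coef.
rewrite !rmorph_sum; apply: eq_bigr => k _ /=.
rewrite coef_map /= -!scalerAl !mul1r !rmorphZ_num [in RHS]rmorphM /= fmorph_rat.
by rewrite !rmorphXn /= fmorphV conj_iota_zeta.
Qed.

Fact bar_zmod : zmod_morphism (bar iota).
Proof. by move=> x y; apply: (fmorph_inj iota); rewrite rmorphB !iota_bar /= rmorphB /= rmorphB. Qed.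
Fact bar_monoid : monoid_morphism (bar iota).
Proof.
split=> [|x y]; apply: (fmorph_inj iota).
  by rewrite iota_bar !rmorph1.
by rewrite rmorphM !iota_bar /= rmorphM /= rmorphM.
Qed.
(** Packs [bar] as a ring morphism, to use the morphism lemmas on it. *)
Definition bar_rmorph : {rmorphism F -> F} :=
  HB.pack (bar iota) (GRing.isZmodMorphism.Build _ _ _ bar_zmod)
    (GRing.isMonoidMorphism.Build _ _ _ bar_monoid).
Local Notation barM := bar_rmorph.
Lemma barME x : barM x = bar iota x. Proof. by []. Qed.

Lemma bar_zeta : barM zeta = zeta^-1.
Proof.
by apply: (fmorph_inj iota); rewrite barME iota_bar conj_iota_zeta fmorphV.
Qed.

Lemma zetaV : zeta^-1 = zeta ^+ 8.
Proof.
apply: (mulfI zeta_neq0); rewrite divff ?zeta_neq0 // -exprS.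
by rewrite (prim_expr_order z9).
Qed.

Lemma zetaXn m k : zeta ^+ (9 * m + k)%N = zeta ^+ k.
Proof. by rewrite exprD exprM (prim_expr_order z9) expr1n mul1r. Qed.

(** * Traces of roots of unity *)

(** The Ramanujan sum of modulus 9, the trace of [zeta^k]. *)
Definition tr9 (k : nat) : int :=
  if (9 %| k)%N then 6 else if (3 %| k)%N then -3 else 0.

Lemma tr9_mod m k : tr9 (9 * m + k)%N = tr9 k.
Proof.
have d9 : (9 %| 9 * m)%N by exact: dvdn_mulr.
have d3 : (3 %| 9 * m)%N by apply: dvdn_trans d9.
by rewrite /tr9 (dvdn_addr _ d9) (dvdn_addr _ d3).
Qed.

(** The sum [1 + zeta^-3 + zeta^-6] vanishes. *)
Lemma TrFQ_triple (u : F) j :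
  TrFQ (u * zeta ^- j) + TrFQ (u * zeta ^- (j + 3)) + TrFQ (u * zeta ^- (j + 6)) = 0.
Proof.
rewrite -!TrFQD -[RHS](raddf0 (galTrace 1%AS {:F}%AS)); congr galTrace.
rewrite -!mulrDr.
suff -> : zeta ^- j + zeta ^- (j + 3) + zeta ^- (j + 6) = 0 by rewrite mulr0.
have h := phi_zeta z9; have z0 := zeta_neq0.
transitivity (zeta ^- (j + 6) * (zeta ^+ 6 + zeta ^+ 3 + 1)).
  by rewrite !exprD; field; rewrite z0 expf_neq0.
by rewrite h mulr0.
Qed.

(** The Fourier expansion of 1 expresses 9 by the traces [r' j] of [zeta^-j]. Comparing
    coefficients on the free family [1, ..., zeta^5] and adding the relations
    [e3] gives nine independent linear equations for nine unknowns. *)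
Lemma TrFQ_zetaXn k : TrFQ (zeta ^+ k) = (tr9 k)%:~R.
Proof.
have /fin_all_exists[r er] : forall j : 'I_9, exists r : rat, TrFQ (zeta ^- j) = r%:A.
  by move=> j; exact: (@TrFQ_rat F).
have e9 := fourier9 z9 zgen 1.
(* [r] with indices in [nat], to write them as numerals. *)
pose r' j := if insub j is Some i then r i else 0.
have er' j : (j < 9)%N -> TrFQ (zeta ^- j) = (r' j)%:A.
  by move=> hj; rewrite /r' insubT -er.
have e3 j : (j < 3)%N -> r' j + r' (j + 3)%N + r' (j + 6)%N = 0 :> rat.
  move=> hj; have := TrFQ_triple 1 j.
  rewrite !mul1r !er' ?(leq_trans hj) -?scalerDl //; try by lia.
  by move/eqP; rewrite scaler_eq0 oner_eq0 orbF => /eqP.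
pose q : {poly rat} := Poly [:: r' 0%N - r' 6%N - 9; r' 1%N - r' 7%N; r' 2%N - r' 8%N;
   r' 3%N - r' 6%N; r' 4%N - r' 7%N; r' 5%N - r' 8%N].
have q0 : q = 0.
  apply: (evq_inj0 z9); first exact: size_Poly.
  rewrite /evq /q map_Poly_id0 ?rmorph0 // horner_Poly /=.
  have s := phi_zeta z9.
  have {}s : zeta ^+ 6 = - zeta ^+ 3 - 1 by rewrite -[LHS]subr0 -s; ring.
  move: e9; rewrite (eq_bigr (fun j : 'I_9 => (r' j)%:A * zeta ^+ j)); last first.
    by move=> j _; rewrite mul1r er' //.
  rewrite !big_ord_recl big_ord0 /= /bump /= !add1n.
  (* The powers [zeta^6, zeta^7, zeta^8] are brought back to the free family. *)
  rewrite (exprD zeta 6 1) (exprD zeta 6 2) s => e9.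
  have nine : (9 : rat)%:A = 9 :> F by rewrite -[LHS]/(in_alg F _) rmorph_nat.
  rewrite !scalerBl nine -[9]mulr1 e9; ring.
have c i := congr1 (fun p : {poly rat} => p`_i) q0.
have := c 0%N; have := c 1%N; have := c 2; have := c 3; have := c 4; have := c 5.
rewrite /q !coef_Poly /= !coef0 => c5 c4 c3 c2 c1 c0.
have := e3 0%N isT; have := e3 1%N isT; have := e3 2%N isT; rewrite /= => s2 s1 s0.
rewrite (divn_eq k 9) mulnC zetaXn tr9_mod.
have : (k %% 9 < 9)%N by rewrite ltn_mod.
have E j m : (0 < j < 9)%N -> r' j = m%:~R -> TrFQ (zeta ^+ (9 - j)) = m%:~R.
  move=> hj ej; have -> : zeta ^+ (9 - j) = zeta ^- j.
    apply: (mulIf (expf_neq0 j zeta_neq0)).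
    by rewrite mulVf ?expf_neq0 ?zeta_neq0 // -exprD subnK ?(prim_expr_order z9) //; lia.
  by rewrite er' ?ej -?[LHS]/(in_alg F _) ?rmorph_int //; lia.
case: (k %% 9)%N => [|[|[|[|[|[|[|[|[|]]]]]]]]] // _; rewrite /tr9 /=.
- rewrite -[zeta ^+ 0]invr1 -[X in X^-1](expr0 zeta) er' // -[LHS]/(in_alg F _).
  have -> : r' 0%N = 6%:~R :> rat by lra.
  by rewrite rmorph_int.
- by apply: (@E 8) => //; lra.
- by apply: (@E 7) => //; lra.
- by apply: (@E 6) => //; lra.
- by apply: (@E 5) => //; lra.
- by apply: (@E 4) => //; lra.
- by apply: (@E 3) => //; lra.
- by apply: (@E 2) => //; lra.
- by apply: (@E 1%N) => //; lra.
Qed.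

End Conjugation.

(** * The lattice and its dual *)

Section Duality.
Variables (R : realType) (F : splittingFieldType rat).
Variables (iota : {rmorphism F -> R[i]}) (zeta : F).
Hypothesis hF : is_Q_zeta9 iota zeta.
Notation algint := (integralOver (intr : int -> F)).
Notation ev := (eval_zeta zeta).
Notation barM := (bar_rmorph hF).
Let z9 : 9.-primitive_root zeta := zeta_prim hF.
Let zgen : <<1; zeta>>%VS = fullv := hF.2.
Let z0 : zeta != 0 := zeta_neq0 hF.

Definition dual_gen : F := 3^-1 * (1 - zeta ^+ 4).
Definition lattice_gen : F := 3^-1 * (1 - zeta) * (1 - zeta^-1).

Local Notation mu := dual_gen.
Local Notation lam := lattice_gen.

Lemma zeta9E : zeta ^+ 9 = 1. Proof. exact: prim_expr_order z9. Qed.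
Lemma zeta6E : zeta ^+ 6 = - zeta ^+ 3 - 1.
Proof. by rewrite -[LHS]subr0 -(phi_zeta z9); ring. Qed.

Lemma three_neq0 : 3 != 0 :> F.
Proof. by rewrite -(rmorph_nat (in_alg F)) fmorph_eq0. Qed.

Lemma one_sub_neq0 k : ~~ (9 %| k)%N -> 1 - zeta ^+ k != 0.
Proof. by rewrite subr_eq0 eq_sym -(prim_order_dvd z9). Qed.

Lemma intr_F_inj : injective (intr : int -> F).
Proof.
move=> a b; rewrite -!(rmorph_int (in_alg F)) => /fmorph_inj; exact: intr_inj.
Qed.

Lemma lam_neq0 : lam != 0.
Proof.
rewrite /lattice_gen (zetaV hF) !mulf_neq0 ?invr_eq0 ?three_neq0 ?one_sub_neq0 //.
by rewrite -[zeta]expr1 one_sub_neq0.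
Qed.
Lemma mu_neq0 : mu != 0.
Proof. by rewrite /dual_gen mulf_neq0 ?invr_eq0 ?three_neq0 ?one_sub_neq0. Qed.

Lemma bar_lam : barM lam = lam.
Proof.
rewrite /lattice_gen !(rmorphM barM) (fmorphV barM) rmorph_nat !(rmorphB barM) rmorph1.
by rewrite (fmorphV barM) (bar_zeta hF) invrK; ring.
Qed.

Lemma bar_algint x : algint x -> algint (barM x).
Proof.
case=> p pm px; exists p => //.
rewrite -(fmorph_root barM) -map_poly_comp in px.
by rewrite (eq_map_poly (g := intr)) // in px => a; exact: (rmorph_int barM).
Qed.

Lemma LambdaE y : Lambda zeta y <-> exists2 a, algint a & y = lam * a.
Proof. by split=> [[a ha <-]|[a ha ->]]; exists a. Qed.

(** Up to the factor 1/9, [mu lam] is an integral combination of powers of [zeta]. Within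
    each class of exponents modulo 3 the coefficients add up to a multiple of 3, and
    the two nonzero values of [tr9] differ by 9, so the combination of traces is a
    multiple of 9. *)
Lemma Tr_mu_lam k : exists m : int, TrFQ (mu * lam * zeta ^+ k) = m%:~R.
Proof.
have e : mu * lam * zeta ^+ k = (9^-1 : rat) *:
   (zeta ^+ k *+ 2 - zeta ^+ (k + 1) + zeta ^+ (k + 3) - zeta ^+ (k + 4) *+ 2
   + zeta ^+ (k + 5) - zeta ^+ (k + 8)).
  rewrite -[X in _ = _ *: X]mul1r scalerAl /dual_gen /lattice_gen (zetaV hF) !exprD.
  have -> : (9^-1 : rat)%:A = 3^-1 * 3^-1 :> F.
    rewrite -[LHS]/(in_alg F _) fmorphV rmorph_nat -invfM; congr _^-1; ring.
  have h := zeta9E; ring: h.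
have trN (x : F) : TrFQ (- x) = - TrFQ x by exact: raddfN.
rewrite e TrFQZ !mulr2n !(TrFQD, trN) !(TrFQ_zetaXn hF).
rewrite -!(rmorphD, rmorphN) /=.
set c := (X in X%:~R); have /dvdzP[m ->] : (9 %| c)%Z.
  rewrite /c {c}; have trm i : tr9 (k + i)%N = tr9 (k %% 9 + i)%N.
    by rewrite {1}(divn_eq k 9) mulnC -addnA tr9_mod.
  rewrite !trm -[k]addn0 !trm !addn0.
  have : (k %% 9 < 9)%N by rewrite ltn_mod.
  by case: (k %% 9)%N => [|[|[|[|[|[|[|[|[|]]]]]]]]].
exists m; rewrite rmorphM /= -[9%:~R](rmorph_int (in_alg F)) /=.
rewrite -scalerAr mulr1 scalerA mulVf ?scale1r //.
Qed.

Lemma TrFQMint (c : int) (u : F) : TrFQ (c%:~R * u) = c%:~R * TrFQ u.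
Proof. by rewrite -(rmorph_int (in_alg F)) TrFQM. Qed.

(** Both inclusions use that [1 - zeta^4] and [1 - zeta^-1] differ from [1 - zeta] by units:
    the geometric sums in the witnesses are [(1 - zeta) / (1 - zeta^4)], as
    [zeta = zeta^28], and [(1 - zeta^4) / (1 - zeta^8)], as [zeta^4 = zeta^40]. *)
Lemma LambdaP y : Lambda zeta y <-> exists p, y = mu * ev p /\ (3 %| p.[1])%Z.
Proof.
rewrite LambdaE; split=> [[a /(algintP z9 zgen)[p ->] ->]|[p [-> /dvdzP[m pm]]]].
  exists ((1 - 'X^8) * (1 + 'X^4 + 'X^8 + 'X^12 + 'X^16 + 'X^20 + 'X^24) * p).
  split; last by rewrite !hornerE /= ?expr1n ?subrr ?mul0r.
  rewrite !evE /dual_gen /lattice_gen (zetaV hF); have h := zeta9E; ring: h.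
rewrite mulrC in pm; have [q ->] := ev_div_prime z9 pm.
exists (ev ((1 + 'X^8 + 'X^16 + 'X^24 + 'X^32) * q)); first exact: algint_ev.
rewrite !evE /dual_gen /lattice_gen (zetaV hF); have h := zeta9E; ring: h.
Qed.

Lemma dual_trace x j : Lambda_dual iota zeta x ->
  exists m : int, TrFQ (x * lam * zeta ^- j) = m%:~R.
Proof.
move=> hx; have [|m em] := hx (lam * zeta ^+ j).
  by apply/LambdaE; exists (zeta ^+ j) => //; apply: algintX (algint_zeta z9).
exists m; rewrite -em -(barME hF) (rmorphM barM) (rmorphXn barM) (bar_zeta hF) bar_lam.
by rewrite exprVn [in RHS]mulrA.
Qed.

(** From left to right: the integers [m' j], the traces of [x lam zeta^-j], give
    [9 x lam] by Fourier inversion; the relation [e3] between them makes the result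
    divisible by [1 - zeta^3], which is [9 mu lam (1 + zeta^8)]. From right to left, the
    trace form is linear and [Tr_mu_lam] treats the powers of [zeta]. *)
Lemma dualP x : Lambda_dual iota zeta x <-> exists p, x = mu * ev p.
Proof.
split=> [hx|[p ->] y].
  have /fin_all_exists[m em] : forall j : 'I_9,
      exists m : int, TrFQ (x * lam * zeta ^- j) = m%:~R.
    by move=> j; exact: dual_trace.
  pose m' j := if insub j is Some i then m i else 0.
  have em' j : (j < 9)%N -> TrFQ (x * lam * zeta ^- j) = (m' j)%:~R.
    by move=> hj; rewrite /m' insubT -em.
  have e3 j : (j < 3)%N -> m' (j + 6)%N = - m' j - m' (j + 3)%N.
    move=> hj; apply: intr_F_inj.
    have := TrFQ_triple hF (x * lam) j.
    rewrite !em' ?(leq_trans hj) //; try by lia.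
    by rewrite rmorphB rmorphN /= => h; rewrite -[LHS]subr0 -h; ring.
  have := fourier9 z9 zgen (x * lam).
  rewrite (eq_bigr (fun j : 'I_9 => (m' j)%:~R * zeta ^+ j)); last first.
    by move=> j _; rewrite em'.
  have := e3 0%N isT; have := e3 1%N isT; have := e3 2%N isT.
  rewrite /= ?add0n ?add1n ?add2n => e2 e1 e0.
  rewrite !big_ord_recl big_ord0 /= /bump /= !add1n e0 e1 e2 => e9.
  pose q : {poly int} := (m' 0%N)%:P * (1 + 'X^3) + (m' 3)%:P * 'X^3 +
    'X * ((m' 1%N)%:P * (1 + 'X^3) + (m' 4)%:P * 'X^3) +
    'X^2 * ((m' 2)%:P * (1 + 'X^3) + (m' 5)%:P * 'X^3).
  have {}e9 : 9 * (x * lam) = (1 - zeta ^+ 3) * ev q.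
    rewrite e9 /q !evE; have h := zeta6E; ring: h.
  (* Only [e9] matters from here on; unfolding [q] would defeat [ring]. *)
  clearbody q.
  exists ((1 + 'X^8) * q).
  have n9 : 9 * lam != 0.
    rewrite mulf_neq0 ?lam_neq0 // (_ : 9 = 3 * 3) ?mulf_neq0 ?three_neq0 //; ring.
  apply: (mulIf n9); rewrite mulrCA e9 evM !evD ev1 evXn.
  rewrite /dual_gen /lattice_gen (zetaV hF); have h := zeta9E.
  have t3 := three_neq0.
  transitivity ((1 - zeta ^+ 4) * (1 - zeta) * (1 - zeta ^+ 8) * (1 + zeta ^+ 8) * ev q).
    by have h' := zeta6E; ring: h'.
  by field.
move=> /LambdaE[a ha ->].
rewrite -(barME hF) (rmorphM barM) bar_lam.
have /(algintP z9 zgen)[b ->] := bar_algint ha.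
have -> : mu * ev p * (lam * ev b) = mu * lam * ev (p * b).
  by rewrite evM; ring.
rewrite /eval_zeta horner_coef mulr_sumr TrFQ_sum.
pose f k := projT1 (sig_eqW (Tr_mu_lam k)).
have ef k : TrFQ (mu * lam * zeta ^+ k) = (f k)%:~R by rewrite /f; case: sig_eqW.
exists (\sum_(i < size (map_poly (intr : int -> F) (p * b))) (p * b)`_i * f i).
rewrite rmorph_sum; apply: eq_bigr => i _; rewrite coef_map /= intrM.
by rewrite mulrCA TrFQMint ef.
Qed.

End Duality.

(** * The map rho and the cosets of the lattice *)

Section Reduction.
Variables (R : realType) (F : splittingFieldType rat).
Variables (iota : {rmorphism F -> R[i]}) (zeta : F).
Hypothesis hF : is_Q_zeta9 iota zeta.
Notation ev := (eval_zeta zeta).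
Notation mu := (dual_gen zeta).
Let z9 : 9.-primitive_root zeta := zeta_prim hF.
Let zgen : <<1; zeta>>%VS = fullv := hF.2.
Let z0 : zeta != 0 := zeta_neq0 hF.

(** Division by the monic [Phi9] changes [p.[1]] by a multiple of [Phi9.[1] = 3] only, so
    that the residue of [p.[1]] can be read on a representative of degree at most 5. *)
Lemma ev_reduce (p : {poly int}) : exists r : {poly int},
  [/\ (size r <= 6)%N, ev p = ev r & exists m, p.[1] = 3 * m + r.[1]].
Proof.
have mP := monic_Phi9; have e := Pdiv.RingMonic.rdivp_eq mP p.
exists (Pdiv.Ring.rmodp p Phi9); split.
- by rewrite -ltnS -size_Phi9 Pdiv.Ring.ltn_rmodpN0 ?monic_neq0.
- by rewrite {1}e evD evM (ev_Phi9 z9) mulr0 add0r.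
- exists (Pdiv.Ring.rdivp p Phi9).[1]; rewrite {1}e hornerD hornerM.
  by rewrite [Phi9.[1]](_ : _ = 3) 1?mulrC // /Phi9 !hornerE /= ?expr1n.
Qed.

Lemma fdualE (j : 'I_6) : fdual zeta j =
  mu * zeta ^- 2 * (zeta ^+ j + (if (j < 3)%N then 0 else zeta ^+ (j - 3))).
Proof.
have e k : (k < 6)%N -> zeta ^ (k.+1%:Z - 3) = zeta ^- 2 * zeta ^+ k.
  by move=> _; rewrite exprnN exprnP -expfzDr //; congr (_ ^ _); lia.
have e' k : (3 <= k)%N -> zeta ^ (k.+1%:Z - 6) = zeta ^- 2 * zeta ^+ (k - 3).
  by move=> hk; rewrite exprnN exprnP -expfzDr //; congr (_ ^ _); lia.
rewrite /fdual -/mu; case: ltnP => hj; first by rewrite addr0 e // mulrA.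
by rewrite e // e' // -mulrDr mulrA.
Qed.

Notation fd := [tuple fdual zeta j | j < 6].

(** Up to the common factor [mu zeta^-2], the [f_j^*] are [zeta^j] for [j < 3] and
    [zeta^j + zeta^(j-3)] for [j >= 3], hence a triangular system over the powers of
    [zeta]. *)
Lemma fdual_sum (c : nat -> rat) : \sum_(j < 6) c j *: fd`_j =
  mu * zeta ^- 2 * evq zeta
    (Poly [:: c 0%N + c 3; c 1%N + c 4; c 2 + c 5; c 3; c 4; c 5]).
Proof.
rewrite /evq map_Poly_id0 ?rmorph0 // horner_Poly /=.
transitivity (\sum_(j < 6) (c j)%:A * fdual zeta j).
  apply: eq_bigr => j _; rewrite nth_mktuple.
  by rewrite -[in RHS]scalerAl mul1r.
rewrite !big_ord_recl big_ord0 !fdualE /= /bump /= !scalerDl; ring.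
Qed.

Lemma fdual_free : free fd.
Proof.
apply/freeP => k hk i.
pose c j := if insub j is Some i then k i else 0.
have ck (j : 'I_6) : c j = k j by rewrite /c valK.
have : \sum_(j < 6) c j *: fd`_j = 0.
  by rewrite -[RHS]hk; apply: eq_bigr => j _; rewrite ck.
have nz : mu * zeta ^- 2 != 0 by rewrite mulf_neq0 ?(mu_neq0 hF) ?invr_eq0 ?expf_neq0.
rewrite fdual_sum; set q := Poly _.
have sq : (size q <= 6)%N by exact: size_Poly.
move=> /eqP; rewrite mulf_eq0 (negPf nz) orFb => /eqP /(evq_inj0 z9 sq) e.
have h j := congr1 (fun p : {poly rat} => p`_j) e.
have := h 0%N; have := h 1%N; have := h 2; have := h 3; have := h 4; have := h 5.
rewrite /q !coef_Poly /= !coef0 => c5 c4 c3.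
rewrite c3 c4 c5 !addr0 => c2 c1 c0; rewrite -ck.
by case: i => [[|[|[|[|[|[|]]]]]]].
Qed.

(** The action of [rho] on one entry of a vector. *)
Definition rho_entry (x : F) : 'Z_3 :=
  (\sum_(j < 6 | (j < 3)%N) fdual_coord zeta x j
           - \sum_(j < 6 | (3 <= j)%N) fdual_coord zeta x j)%:~R.

Lemma intr_Z3 (m : int) : (m%:~R == 0 :> 'Z_3) = (3 %| m)%Z.
Proof. by rewrite (@dvdz_pcharf 'Z_3 3) //; exact: (@pchar_Fp 3). Qed.

(** Reading off the [f_j^*]-coordinates, the alternating sum in [rho] differs from the sum
    of the coefficients of the reduced polynomial, its value at 1, by a multiple of 3. *)
Lemma rho_entry_ev p : rho_entry (mu * ev p) = p.[1]%:~R.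
Proof.
have -> : mu * ev p = mu * zeta ^- 2 * ev ('X^2 * p).
  by rewrite evM evXn mulrA mulfVK // expf_neq0.
have [r [sr -> [m pm]]] := ev_reduce ('X^2 * p).
have -> : p.[1] = 3 * m + r.[1] by rewrite -pm !hornerE /= ?expr1n ?mul1r.
pose c j : int := if (j < 3)%N then r`_j - r`_(j + 3)%N else r`_j.
have -> : mu * zeta ^- 2 * ev r = \sum_(j < 6) (c j)%:~R *: fd`_j.
  rewrite (fdual_sum (fun j => (c j)%:~R)); congr (_ * _).
  rewrite /eval_zeta /evq; congr (_.[_]).
  apply/polyP => i; rewrite coef_map [RHS]coef_map coef_Poly /c /=.
  have E (a : int) : (a%:~R : rat)%:A = a%:~R :> F.
    by rewrite -[LHS]/(in_alg F _) rmorph_int.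
  move: i => [|[|[|[|[|[|i]]]]]] /=; rewrite ?intrB ?subrK ?E //.
  by rewrite !nth_default ?scale0r // (leq_trans sr).
have fc (j : 'I_6) : fdual_coord zeta (\sum_(j < 6) (c j)%:~R *: fd`_j) j = c j.
  by rewrite /fdual_coord (coord_sum_free _ _ fdual_free) numq_int.
rewrite /rho_entry !(eq_bigr _ (fun j _ => fc j)).
rewrite (horner_coef_wide _ sr).
have three k : (3 * k)%:~R = 0 :> 'Z_3 by apply/eqP; rewrite intr_Z3 dvdz_mulr.
rewrite [in RHS]intrD three add0r.
(* The multiple of 3 is the difference between the two sides as integers. *)
transitivity ((\sum_(i < 6) r`_i * 1 ^+ i + 3 * (- r`_3 - r`_4 - r`_5))%:~R : 'Z_3).
  congr _%:~R; rewrite big_mkcond [X in _ - X = _]big_mkcond !big_ord_recl !big_ord0.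
  rewrite /= /bump /= /c /= !expr1n !(addn0, add0n, add1n, addSn).
  ring.
by rewrite intrD three addr0.
Qed.

(** The representative [f_1^*] is [mu zeta^-2 = mu zeta^7]. *)
Lemma coset_repE (a : 'I_3) :
  exists2 p, coset_rep zeta a = mu * ev p & (p.[1])%:~R = (a : nat)%:R :> 'Z_3.
Proof.
have e : fdual zeta ord0 = mu * ev 'X^7.
  rewrite fdualE /= expr0 addr0 mulr1 evXn; congr (_ * _).
  apply: (mulfI (expf_neq0 2 z0)); rewrite divff ?expf_neq0 // -exprD.
  by rewrite (prim_expr_order z9).
case: a => [[|[|[|a]]]] ha //=; rewrite /coset_rep /=.
- by exists 0; rewrite ?horner0 // /eval_zeta rmorph0 horner0 mulr0.
- by exists 'X^7; rewrite // hornerXn expr1n.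
- exists (- 'X^7); first by rewrite evN mulrN e.
  by rewrite hornerN hornerXn expr1n; apply/eqP.
Qed.

(** Two points [mu p(zeta)] and [mu r(zeta)] differ by an element of [Lambda] exactly when
    [p.[1] - r.[1]] is divisible by 3, which is the equality of their residues. *)
Lemma coset_LambdaP (a : 'I_3) x :
  (exists2 y, Lambda zeta y & coset_rep zeta a + y = x) <->
  Lambda_dual iota zeta x /\ rho_entry x = (a : nat)%:R.
Proof.
have [r er r1] := coset_repE a; rewrite er -r1; split.
  case=> y /(LambdaP hF)[p [-> p1]] <-.
  have e : mu * ev r + mu * ev p = mu * ev (r + p) by rewrite evD mulrDr.
  split; first by apply/(dualP hF); exists (r + p).
  rewrite e rho_entry_ev hornerD intrD; apply/eqP.
  by rewrite -subr_eq0 addrAC subrr add0r intr_Z3.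
case=> /(dualP hF)[p ->]; rewrite rho_entry_ev => /eqP.
rewrite -subr_eq0 -intrB intr_Z3 => h.
exists (mu * ev (p - r)); last by rewrite evB mulrBr addrC subrK.
by apply/(LambdaP hF); exists (p - r); rewrite hornerD hornerN.
Qed.

End Reduction.

(** * Unconditional complex sums *)

Section Modulus.
Local Open Scope classical_set_scope.
Variable R : realType.
Implicit Types w : R[i].
(** The modulus as a real number; [`|w|] is an element of [R[i]]. *)
Definition cmod w : R := complex.Re `|w|.
Lemma cmodE w : `|w| = (cmod w)%:C.
Proof. by rewrite /cmod normc_def. Qed.
Lemma cmod_ge0 w : 0 <= cmod w.
Proof. by rewrite -ler0c -cmodE. Qed.
Lemma cmodM w1 w2 : cmod (w1 * w2) = cmod w1 * cmod w2.
Proof. by apply: complexI; rewrite -cmodE normrM !cmodE rmorphM. Qed.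
Lemma cmod_prod (I : Type) (r : seq I) (P : pred I) (f : I -> R[i]) :
  cmod (\prod_(i <- r | P i) f i) = \prod_(i <- r | P i) cmod (f i).
Proof.
apply: complexI; rewrite -cmodE normr_prod rmorph_prod.
by apply: eq_bigr => i _; rewrite cmodE.
Qed.
Lemma cmod0 : cmod 0 = 0.
Proof. by rewrite /cmod normr0. Qed.
Lemma Re_le_cmod w : `|complex.Re w| <= cmod w.
Proof. by rewrite -lecR -cmodE normc_ge_Re. Qed.
Lemma Im_le_cmod w : `|complex.Im w| <= cmod w.
Proof.
rewrite -lecR -cmodE normc_def lecR -sqrtr_sqr ler_wsqrtr //.
by rewrite lerDr sqr_ge0.
Qed.
Lemma cmod_le w : cmod w <= `|complex.Re w| + `|complex.Im w|.
Proof.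
have e : w = (complex.Re w)%:C + (0 +i* complex.Im w).
  by case: w => a b; apply/eqP; rewrite eq_complex /= addr0 add0r !eqxx.
rewrite -lecR -cmodE {1}e (le_trans (ler_normD _ _)) // rmorphD /=.
by rewrite !normc_def /= expr0n /= addr0 add0r !sqrtr_sqr.
Qed.
End Modulus.

Section Sums.
Local Open Scope classical_set_scope.
Variable R : realType.

Lemma ler_sum_sub (T : eqType) (h : T -> R) (s1 s2 : seq T) :
  (forall x, 0 <= h x) -> uniq s1 -> {subset s1 <= s2} ->
  \sum_(x <- s1) h x <= \sum_(x <- s2) h x.
Proof.
move=> h0; elim: s1 s2 => [|x s1 IH] s2 /=.
  by move=> _ _; rewrite big_nil sumr_ge0.
move=> /andP[xs us] sub; have xs2 : x \in s2 by apply: sub; rewrite mem_head.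
rewrite big_cons (perm_big _ (perm_to_rem xs2)) /= big_cons lerD2l.
apply: IH => // y ys; have := sub y; rewrite (perm_mem (perm_to_rem xs2)).
rewrite !inE ys orbT => /(_ isT) /orP[/eqP yx|//].
by rewrite -yx ys in xs.
Qed.

Lemma partial_sumE (I : choiceType) (V : zmodType) (f : I -> V) (A : {fset I}) :
  partial_sum f A = \sum_(i <- A) f i.
Proof. by rewrite /partial_sum big_seq_fsetE. Qed.

(** The supremum of the partial sums is their limit, by monotonicity in the finite set. *)
Lemma cvg_sum_ge0 (I : choiceType) (h : I -> R) (M : R) :
  (forall i, 0 <= h i) -> (forall A : {fset I}, \sum_(i <- A) h i <= M) ->
  cvg (partial_sum h @ totally).
Proof.
move=> h0 hM; pose E := range (partial_sum h : {fset I} -> R).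
have supE : has_sup E.
  split; first by exists (partial_sum h fset0); exists fset0.
  by exists M => _ [A _ <-]; rewrite partial_sumE.
apply/cvg_ex; exists (sup E); apply/cvgrPdist_lt => e e0.
have [_ [A _ <-] hA] := sup_adherent e0 supE.
exists A => // B /= AB; rewrite ger0_norm ?subr_ge0.
  rewrite ltrBlDr -ltrBlDl (lt_le_trans hA) // !partial_sumE ler_sum_sub ?fset_uniq //.
  exact: fsubsetP.
by apply: sup_upper_bound => //; exists B.
Qed.

(** A real term is the difference of the nonnegative terms [`|h i| + h i] and [`|h i|]. *)
Lemma cvg_sum_abs (I : choiceType) (h : I -> R) (M : R) :
  (forall A : {fset I}, \sum_(i <- A) `|h i| <= M) ->
  cvg (partial_sum h @ totally).
Proof.
move=> hM.
have -> : partial_sum h =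
    (fun A : {fset I} => partial_sum (fun i => `|h i| + h i) A - partial_sum (fun i => `|h i|) A).
  by apply/funext => A; rewrite !partial_sumE -sumrB; apply: eq_bigr => i _; ring.
have c1 : cvg (partial_sum (fun i => `|h i|) @ totally) by exact: cvg_sum_ge0 hM.
have c2 : cvg (partial_sum (fun i => `|h i| + h i) @ totally).
  apply: (@cvg_sum_ge0 _ _ (M + M)) => [i|A].
    by have := ler_norm (- h i); rewrite normrN; lra.
  rewrite big_split lerD //= (le_trans _ (hM A)) // ler_sum // => i _; exact: ler_norm.
apply/cvg_ex; eexists; apply: cvgB; [exact: c2 | exact: c1].
Qed.

Lemma cvg_complex (T : Type) (G : set_system T) (FG : Filter G) (u : T -> R[i]) (a b : R) :
  complex.Re (u x) @[x --> G] --> a -> complex.Im (u x) @[x --> G] --> b ->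
  (u : T -> R[i]^o) @ G --> (a +i* b : R[i]^o).
Proof.
move=> ha hb; apply/cvgrPdist_lt => e e0.
have [r er] : exists r : R, e = r%:C.
  by apply/complex_realP; rewrite realE ltW.
rewrite er in e0 *; rewrite ltcR in e0.
have r2 : 0 < r / 2 by rewrite divr_gt0.
move/cvgrPdist_lt/(_ _ r2) : ha => ha; move/cvgrPdist_lt/(_ _ r2) : hb => hb.
near=> x.
have h1 : `|a - complex.Re (u x)| < r / 2 by near: x.
have h2 : `|b - complex.Im (u x)| < r / 2 by near: x.
rewrite [X in X < _]cmodE ltcR (le_lt_trans (cmod_le _)) //.
by case: (u x) h1 h2 => c d /= h1 h2; rewrite [ltRHS](splitr r) ltrD.
Unshelve. all: by end_near. Qed.

(** Real and imaginary parts are dominated by the modulus, so both are absolutely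
    summable. *)
Lemma cvg_csum (I : choiceType) (S : set I) (f : I -> R[i]) (M : R) :
  (forall A : {fset I}, \sum_(i <- A) cmod (patch (fun=> 0) S f i) <= M) ->
  (partial_sum (patch (fun=> 0) S f : I -> R[i]^o) @ totally) --> (csum S f : R[i]^o).
Proof.
move=> hM; rewrite /csum /summability.sum; set g := patch _ _ _.
have part (p : R[i] -> R) : (forall w1 w2, p (w1 + w2) = p w1 + p w2) -> p 0 = 0 ->
    (forall w, `|p w| <= cmod w) ->
    exists a : R, p (partial_sum (g : I -> R[i]^o) A) @[A --> totally] --> a.
  move=> pD p0 ple; have : cvg (partial_sum (fun i => p (g i)) @ totally).
    apply: (@cvg_sum_abs _ _ M) => A; apply: le_trans (hM A).
    by apply: ler_sum => i _; exact: ple.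
  rewrite (_ : partial_sum _ = fun A => p (partial_sum (g : I -> R[i]^o) A)).
    by move=> hc; eexists; exact: hc.
  apply/funext => A; rewrite !partial_sumE.
  by elim/big_rec2 : _ => [|i x y _ ->]; rewrite ?p0 ?pD.
have [a ha] := part (@complex.Re R) (fun w1 w2 => raddfD (@complex.Re R) w1 w2) erefl (@Re_le_cmod R).
have [b hb] := part (@complex.Im R) (fun w1 w2 => raddfD (@complex.Im R) w1 w2) erefl (@Im_le_cmod R).
by apply/cvg_ex; exists (a +i* b : R[i]^o); exact: cvg_complex.
Qed.

(** The bijection carries the finite subsets of [I] to those of [J], so both sides are the
    limit of the same partial sums along the same filter. *)
Lemma csum_reindex (I J : choiceType) (phi : I -> J) (psi : J -> I) (S : set J)
    (f : J -> R[i]) : cancel phi psi -> cancel psi phi ->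
  csum S f = csum (phi @^-1` S) (f \o phi).
Proof.
move=> phiK psiK; rewrite /csum /summability.sum.
pose im (A : {fset I}) : {fset J} := [fset phi i | i in A]%fset.
have -> : partial_sum (patch (fun=> 0) (phi @^-1` S) (f \o phi) : I -> R[i]^o) =
    partial_sum (patch (fun=> 0) S f : J -> R[i]^o) \o im.
  apply/funext => A; rewrite /= !partial_sumE big_imfset /=; last first.
    by move=> x y _ _; exact: (can_inj phiK).
  by apply: eq_bigr.
suff -> (u : {fset J} -> R[i]^o) : (u \o im) @ totally = u @ totally by [].
apply/predeqP => P; split.
  case=> A _ hA; exists [fset phi i | i in A]%fset => // B /= /fsubsetP hB.
  have -> : B = im [fset psi j | j in B]%fset.
    apply/fsetP => j; apply/idP/imfsetP => [jB|[i /imfsetP[k /= kB ->] ->]].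
      by exists (psi j); rewrite ?psiK // in_imfset.
    by rewrite psiK.
  apply: hA; apply/fsubsetP => i iA; rewrite -(phiK i) in_imfset //=.
  by apply: hB; rewrite in_imfset.
case=> A _ hA; exists [fset psi j | j in A]%fset => // B /= /fsubsetP hB.
apply: hA; apply/fsubsetP => j jA; rewrite -(psiK j) in_imfset //=.
by apply: hB; rewrite in_imfset.
Qed.

End Sums.

(** * Sums over a product of cosets *)

Section Box.
Local Open Scope classical_set_scope.
Variables (X : choiceType) (n : nat).

Definition boxv (A : {fset X}) (f : {ffun 'I_n -> A}) : 'rV[X]_n := \row_i val (f i).

Definition box (A : {fset X}) : {fset 'rV[X]_n} :=
  [fset v in [seq boxv f | f : {ffun 'I_n -> A}]]%fset.

Lemma mem_box (A : {fset X}) (v : 'rV[X]_n) : reflect (forall i, v 0 i \in A) (v \in box A).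
Proof.
rewrite in_fset; apply: (iffP mapP) => [[f _ ->] i|h]; first by rewrite mxE; exact: fsvalP.
exists [ffun i => [` h i]%fset]; first by rewrite mem_enum.
by apply/rowP => i; rewrite mxE ffunE.
Qed.

(** Distributivity: choosing a vector of the box is choosing one element of [A] per entry. *)
Lemma big_box (V : comNzRingType) (h : 'I_n -> X -> V) (A : {fset X}) :
  \sum_(v <- box A) \prod_i h i (v 0 i) = \prod_i \sum_(x <- A) h i x.
Proof.
have bi : injective (@boxv A).
  move=> f g /rowP e; apply/ffunP => i; apply: val_inj.
  by have := e i; rewrite !mxE.
rewrite (perm_big [seq boxv f | f : {ffun 'I_n -> A}]); last first.
  apply: uniq_perm => [||v]; [exact: fset_uniq | | by rewrite in_fset].
  by rewrite (map_inj_uniq bi) enum_uniq.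
rewrite big_map big_enum /=.
under [RHS]eq_bigr => i _ do rewrite big_seq_fsetE /=.
rewrite bigA_distr_bigA /=; apply: eq_bigr => f _; apply: eq_bigr => i _.
by rewrite mxE.
Qed.

Definition entries (B : {fset 'rV[X]_n}) : {fset X} :=
  [fset x in [seq (v : 'rV[X]_n) 0 i | v <- B, i <- enum 'I_n]]%fset.

Lemma sub_box_entries (B : {fset 'rV[X]_n}) A :
  (entries B `<=` A)%fset -> {subset B <= box A}.
Proof.
move=> /fsubsetP hA v vB; apply/mem_box => i; apply: hA; rewrite in_fset.
by apply/allpairsP; exists (v, i); rewrite /= mem_enum vB.
Qed.

(** Every finite set of vectors lies in a box, so a limit along all finite sets of vectors
    can be computed along boxes. *)
Lemma box_cvg : box @ totally --> totally.
Proof.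
move=> P [B _ hB]; exists (entries B) => // A /= hA; apply: hB => /=.
by apply/fsubsetP; exact: sub_box_entries.
Qed.

Lemma sum_prod_le (R : realType) (h : X -> R) (M : R) :
  (forall x, 0 <= h x) -> (forall A : {fset X}, \sum_(x <- A) h x <= M) ->
  forall B : {fset 'rV[X]_n}, \sum_(v <- B) \prod_i h (v 0 i) <= M ^+ n.
Proof.
move=> h0 hM B.
have prod0 (v : 'rV[X]_n) : 0 <= \prod_i h (v 0 i) by exact: prodr_ge0.
have sub := sub_box_entries (fsubset_refl (entries B)).
apply: le_trans (ler_sum_sub prod0 (fset_uniq B) sub) _.
rewrite (big_box (fun=> h)) -[leRHS](_ : \prod_(i < n) M = _); last by rewrite prodr_const card_ord.
by apply: ler_prod => i _; rewrite hM sumr_ge0.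
Qed.

End Box.

Section Code.
Local Open Scope classical_set_scope.
Variable R : realType.

(** The identity behind weight enumerators. The term at a vector decomposes as the
    sum over the codewords [c] of products of terms cut to the fibres of [r] over the
    [c 0 i] ([decomp]), only the image of the vector contributing. On the box with
    side [A], distributivity turns this into products of partial sums over [A].
    Absolute summability makes each partial sum converge, and also the sum over all
    vectors, whose limit may therefore be taken along boxes. *)
Lemma csum_code (X : choiceType) (D : set X) (r : X -> 'Z_3) (g : X -> R[i]) (M : R)
    (n : nat) (C : {set 'rV['Z_3]_n}) :
  (forall A : {fset X}, \sum_(x <- A) cmod (patch (fun=> 0) D g x) <= M) ->
  csum [set v : 'rV[X]_n | (forall i, D (v 0 i)) /\ \row_i r (v 0 i) \in C]
      (fun v => \prod_i g (v 0 i)) =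
  \sum_(c in C) \prod_i csum [set x | D x /\ r x = c 0 i] g.
Proof.
move=> hM; set S := [set v | _]; set G := fun v : 'rV[X]_n => _.
pose Da a := [set x | D x /\ r x = a].
have hMa a (A : {fset X}) : \sum_(x <- A) cmod (patch (fun=> 0) (Da a) g x) <= M.
  apply: le_trans (hM A); apply: ler_sum => x _; rewrite /patch.
  case: ifPn => [|_]; last by rewrite cmod0 cmod_ge0.
  by rewrite inE => -[Dx _]; rewrite mem_set.
have decomp v : patch (fun=> 0) S G v =
    \sum_(c in C) \prod_i patch (fun=> 0) (Da (c 0 i)) g (v 0 i).
  have zero (c : 'rV['Z_3]_n) : (exists i, ~ Da (c 0 i) (v 0 i)) ->
      \prod_i patch (fun=> 0) (Da (c 0 i)) g (v 0 i) = 0.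
    by move=> [i hi]; rewrite (bigD1 i) //= patchC ?mul0r // inE.
  rewrite {1}/patch; case: ifPn => [|vS].
    rewrite inE => -[hD hC]; rewrite (bigD1 _ hC) /= [X in _ = _ + X]big1 => [|c /andP[_ cv]].
      rewrite addr0; apply: eq_bigr => i _; rewrite patchT // inE; split=> //.
      by rewrite mxE.
    apply: zero; apply: contrapT => h; case/negP: cv; apply/eqP/rowP => i.
    by rewrite mxE; apply: contrapT => hi; apply: h; exists i => -[_ /esym].
  rewrite big1 // => c cC; apply: zero; apply: contrapT => h; case/negP: vS.
  rewrite inE; have {}h i : Da (c 0 i) (v 0 i) by apply: contrapT => hi; apply: h; exists i.
  split=> [i|]; first by have [] := h i.
  rewrite (_ : \row_i _ = c) //; apply/rowP => i; rewrite mxE; by have [] := h i.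
have cS : (partial_sum (patch (fun=> 0) S G : 'rV[X]_n -> R[i]^o) @ totally) -->
    (csum S G : R[i]^o).
  apply: (@cvg_csum _ _ _ _ (M ^+ n)) => B.
  apply: le_trans (sum_prod_le (h := fun x => cmod (patch (fun=> 0) D g x)) _ hM B).
    apply: ler_sum => v _; rewrite {1}/patch; case: ifPn => [|_].
      rewrite inE => -[hD _]; rewrite /G cmod_prod le_eqVlt; apply/orP; left; apply/eqP.
      by apply: eq_bigr => i _; rewrite patchT // inE.
    by rewrite cmod0 prodr_ge0 // => i _; exact: cmod_ge0.
  by move=> x; exact: cmod_ge0.
have cbox := cvg_comp _ _ (@box_cvg X n) cS.
have clim : (fun A : {fset X} => \sum_(c in C) \prod_i
     partial_sum (patch (fun=> 0) (Da (c 0 i)) g : X -> R[i]^o) A) @ totally -->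
   (\sum_(c in C) \prod_i csum (Da (c 0 i)) g : R[i]^o).
  apply: (@cvg_big R[i]^o) => [|c _]; first exact: add_continuous.
  apply: (@cvg_big R[i]^o) => [|i _]; first exact: mul_continuous.
  exact: cvg_csum (hMa _).
apply: (cvg_unique (@norm_hausdorff _ R[i]^o) cbox).
rewrite [X in X @ _](_ : _ = (fun A : {fset X} => \sum_(c in C) \prod_i
     partial_sum (patch (fun=> 0) (Da (c 0 i)) g : X -> R[i]^o) A)) //.
apply/funext => A /=; rewrite partial_sumE.
rewrite (eq_bigr _ (fun v _ => decomp v)).
rewrite exchange_big /=; apply: eq_bigr => c _.
by rewrite (big_box (fun i => patch (fun=> 0) (Da (c 0 i)) g)); apply: eq_bigr => i _; rewrite partial_sumE.
Qed.

End Code.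

(** * Summability over a lattice *)

Section Geometric.
Local Open Scope classical_set_scope.
Variable R : realType.

Lemma sum_geometric_int (q : R) (A : {fset int}) : 0 <= q < 1 ->
  \sum_(k <- A) q ^+ `|k|%N <= 2 / (1 - q).
Proof.
move=> /andP[q0 q1]; pose N := (\max_(k <- A) `|k|).+1%N.
pose s := [seq Posz m | m <- iota 0 N] ++ [seq - Posz m | m <- iota 0 N].
have sub : {subset A <= s}.
  move=> k kA; have kN : (`|k| < N)%N by rewrite ltnS; apply: leq_bigmax_seq.
  rewrite mem_cat; apply/orP; case: (lerP 0 k) => k0; [left|right].
    by apply/mapP; exists `|k|%N; [rewrite mem_iota | rewrite gez0_abs].
  by apply/mapP; exists `|k|%N; [rewrite mem_iota | rewrite ltz0_abs ?opprK].
have q0' (k : int) : 0 <= q ^+ `|k|%N by rewrite exprn_ge0.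
apply: le_trans (ler_sum_sub q0' (fset_uniq A) sub) _.
have geo : \sum_(m <- iota 0 N) q ^+ m <= (1 - q)^-1.
  rewrite -[iota 0 N]/(index_iota 0 N) big_mkord -[leRHS]mul1r ler_pdivlMr ?subr_gt0 //.
  rewrite mulrC -[1 - q]opprB mulNr -subrX1 opprB.
  by rewrite gerBl exprn_ge0.
rewrite big_cat !big_map /= mulrDl mul1r lerD //.
by under eq_bigr do rewrite abszN.
Qed.

(** The injective coordinates [t] move the sum to integer vectors, where the majorant is
    a product of geometric series. *)
Lemma sum_patch_le (X : choiceType) (n : nat) (D : set X) (t : X -> 'rV[int]_n)
    (g : X -> R[i]) (a q : R) :
  0 <= a -> 0 <= q < 1 -> (forall x y, D x -> D y -> t x = t y -> x = y) ->
  (forall x, D x -> cmod (g x) <= a * \prod_i q ^+ `|t x 0%R i|%N) ->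
  forall A : {fset X}, \sum_(x <- A) cmod (patch (fun=> 0) D g x) <= a * (2 / (1 - q)) ^+ n.
Proof.
move=> a0 q01 tinj hg A; have /andP[q0 _] := q01.
pose H (v : 'rV[int]_n) := \prod_i q ^+ `|v 0%R i|%N.
pose s := [seq x <- A | x \in D].
have us : uniq [seq t x | x <- s].
  rewrite map_inj_in_uniq ?filter_uniq ?fset_uniq // => x y.
  by rewrite !mem_filter => /andP[/set_mem Dx _] /andP[/set_mem Dy _]; exact: tinj.
apply: (@le_trans _ _ (a * \sum_(v <- [seq t x | x <- s]) H v)).
  rewrite big_map big_filter mulr_sumr [leRHS]big_mkcond; apply: ler_sum => x _.
  rewrite /patch; case: ifPn => [/set_mem|_]; [exact: hg | by rewrite cmod0].
apply: ler_wpM2l => //.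
have H0 v : 0 <= H v by rewrite prodr_ge0 // => i _; rewrite exprn_ge0.
have sub : {subset [seq t x | x <- s] <= [fset v in [seq t x | x <- s]]%fset}.
  by move=> v; rewrite in_fset.
apply: le_trans (ler_sum_sub H0 us sub) _.
apply: (sum_prod_le (h := fun k : int => q ^+ `|k|%N)) => [k|B].
  by rewrite exprn_ge0.
exact: sum_geometric_int.
Qed.
End Geometric.

(** * The places of the real subfield *)

Section Places.
Variables (R : realType) (F : splittingFieldType rat).
Variables (iota : {rmorphism F -> R[i]}) (zeta : F).
Hypothesis hF : is_Q_zeta9 iota zeta.
Variable sigma : 'I_3 -> gal_of (Kfield zeta).
Hypothesis hsigma : enumerates_Gal sigma.
Notation barM := (bar_rmorph hF).
Let z9 : 9.-primitive_root zeta := zeta_prim hF.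
Let zgen : <<1; zeta>>%VS = fullv := hF.2.
Let z0 : zeta != 0 := zeta_neq0 hF.
Let K := Kfield zeta.

(** Recurrence of the Chebyshev type for [zeta^k + zeta^-k]. *)
Lemma zeta_sum_Kfield k : zeta ^+ k + zeta ^- k \in K.
Proof.
have K1 : zeta + zeta^-1 \in K by exact: memv_adjoin.
have : (zeta ^+ k + zeta ^- k \in K) && (zeta ^+ k.+1 + zeta ^- k.+1 \in K).
  elim: k => [|k /andP[h1 h2]].
    by rewrite !expr0 invr1 !expr1 K1 andbT rpredD ?rpred1.
  rewrite h2 /=.
  have -> : zeta ^+ k.+2 + zeta ^- k.+2 =
      (zeta + zeta^-1) * (zeta ^+ k.+1 + zeta ^- k.+1) - (zeta ^+ k + zeta ^- k).
    by rewrite !exprS; field; rewrite expf_neq0 ?z0.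
  by apply: rpredB => //; apply: rpredM.
by case/andP.
Qed.

(** By linearity, it suffices to treat the powers of [zeta]. *)
Lemma trace_Kfield y : y + barM y \in K.
Proof.
have [q _ ->] := evq_span z9 zgen y.
rewrite /evq horner_coef rmorph_sum -big_split /=; apply: rpred_sum => k _.
rewrite coef_map /= -!scalerAl !mul1r -[bar _ _]/(barM _) rmorphZ_num.
rewrite -alg_num_field -scalerAl mul1r -scalerDr rpredZ //.
by rewrite rmorphXn /= -[bar _ _]/(barM _) (bar_zeta hF) exprVn zeta_sum_Kfield.
Qed.

(** Both compositions are determined by the image of [zeta], a root of unity, on which
    automorphisms commute because they act as powers. *)
Lemma gal_bar (s : gal_of {:F}) x : s (barM x) = barM (s x).
Proof.
have e : (s \o barM : {rmorphism F -> F}) zeta = (barM \o s : {rmorphism F -> F}) zeta.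
  exact: (aut_unity_rootC s barM (n := 9) isT (zeta9E hF)).
exact: (rmorph_zeta_ext z9 zgen e x).
Qed.

(** Every embedding commutes with complex conjugation ([gal_bar]). *)
Lemma iota_gal_norm (s : gal_of {:F}) x :
  iota (s (x * barM x)) = (cmod (iota (s x)) ^+ 2)%:C.
Proof.
have -> : s (x * barM x) = s x * barM (s x) by rewrite -gal_bar; exact: rmorphM.
rewrite (rmorphM iota) barME (iota_bar hF) -sqr_normc cmodE.
by rewrite !expr2 rmorphM.
Qed.

Lemma gal_Q (s : gal_of {:F}) : s \in 'Gal({:F} / 1)%g.
Proof. by rewrite gal_kHom ?sub1v // k1AHom. Qed.

(** Restriction from the field to its normal subfield [K] is a surjection of Galois
    groups, and the [sigma l] exhaust the Galois group of [K]: each [sigma l] extends,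
    and each automorphism restricts to some [sigma l]. *)
Lemma Kfield_galois_data :
  (forall l, exists s : gal_of {:F}, {in K, sigma l =1 s}) /\
  (forall s : gal_of {:F}, exists l, {in K, sigma l =1 s}).
Proof.
have [_ _ simg] := hsigma.
have sK : (1 <= K <= fullv)%VS by rewrite sub1v subvf.
have nK : normalField 1 K.
  apply/forall_inP => f _ /=.
  have lim : (f @: K <= K)%VS.
    rewrite aimg_adjoin aimg1; apply/FadjoinP; split; first exact: sub1v.
    have [k ek] : {k | f zeta = zeta ^+ k}.
      exact: (aut_unity_rootP f (n := 9) isT (zeta9E hF)).
    by rewrite rmorphD fmorphV /= ek zeta_sum_Kfield.
  by rewrite eqEdim lim /= limg_dim_eq // (eqP (AEnd_lker0 f)) capv0.
have eqc (s : gal_of {:F}) : {in K, normalField_cast K s =1 s}.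
  by apply: (normalField_cast_eq sK nK); exact: gal_Q.
split=> [l|s].
  have : sigma l \in 'Gal(K / 1)%g by rewrite -simg imset_f.
  rewrite -(normalField_img (galois1F F) sK nK) => /morphimP[s _ _ ->].
  by exists s; exact: eqc.
have : normalField_cast K s \in 'Gal(K / 1)%g.
  rewrite -(normalField_img (galois1F F) sK nK); apply: mem_morphim => //.
    exact: gal_Q.
  exact: gal_Q.
rewrite -simg => /imsetP[l _ el]; exists l => y yK.
by rewrite -el eqc.
Qed.

End Places.

(** * Decay of the theta terms *)

Section Cexp.
Variable R : realType.
Lemma cexpD (x y : R[i]) : cexp (x + y) = cexp x * cexp y.
Proof.
case: x y => [a b] [c d]; rewrite /cexp /= expRD cosD sinD.
by apply/eqP; rewrite eq_complex /=; apply/andP; split; apply/eqP; ring.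
Qed.
Lemma cexp0 : cexp (0 : R[i]) = 1.
Proof. by rewrite /cexp /= expR0 cos0 sin0 mul1r. Qed.
Lemma cexp_sum (I : Type) (r : seq I) (P : pred I) (f : I -> R[i]) :
  cexp (\sum_(i <- r | P i) f i) = \prod_(i <- r | P i) cexp (f i).
Proof. exact: (big_morph _ cexpD cexp0). Qed.

Lemma cmod_cexp (w : R[i]) : cmod (cexp w) = expR (complex.Re w).
Proof.
apply: complexI; rewrite -cmodE /cexp normrM !normc_def /= cos2Dsin2 sqrtr1 mulr1.
by rewrite expr0n addr0 sqrtr_sqr ger0_norm // expR_ge0.
Qed.
Lemma cmod_int (m : int) : cmod (m%:~R : R[i]) = `|m|%N%:R.
Proof.
apply: complexI; rewrite -cmodE -intr_norm rmorph_nat.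
by rewrite -abszE.
Qed.
Lemma cmod_sum (I : Type) (r : seq I) (P : pred I) (f : I -> R[i]) :
  cmod (\sum_(i <- r | P i) f i) <= \sum_(i <- r | P i) cmod (f i).
Proof.
by rewrite -lecR -cmodE rmorph_sum /= (le_trans (ler_norm_sum _ _ _)) //.
Qed.
End Cexp.

Section Decay.
Local Open Scope classical_set_scope.
Variables (R : realType) (F : splittingFieldType rat).
Variables (iota : {rmorphism F -> R[i]}) (zeta : F).
Hypothesis hF : is_Q_zeta9 iota zeta.
Variable sigma : 'I_3 -> gal_of (Kfield zeta).
Hypothesis hsigma : enumerates_Gal sigma.
Notation barM := (bar_rmorph hF).
Notation lam := (lattice_gen zeta).
Let z9 : 9.-primitive_root zeta := zeta_prim hF.
Let zgen : <<1; zeta>>%VS = fullv := hF.2.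
Let z0 : zeta != 0 := zeta_neq0 hF.

(** Integral coordinates on the dual lattice. Nine of them are redundant for a lattice of
    rank 6, but they are bounded and inverted by one formula each. *)
Definition trace_vec (x : F) : 'rV[int]_9 :=
  \row_j xget 0 [set m : int | TrFQ (x * lam * zeta ^- j) = m%:~R].

Lemma trace_vecE x j : Lambda_dual iota zeta x ->
  TrFQ (x * lam * zeta ^- (j : 'I_9)) = (trace_vec x 0 j)%:~R.
Proof.
move=> hx; rewrite mxE; case: xgetP => [m _ -> //|].
by have [m em] := dual_trace hF j hx; move=> /(_ m); rewrite /= em.
Qed.

(** Fourier inversion recovers [x lam] from its traces. *)
Lemma trace_vec_inj x y : Lambda_dual iota zeta x -> Lambda_dual iota zeta y ->
  trace_vec x = trace_vec y -> x = y.
Proof.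
move=> hx hy e; apply: (mulIf (lam_neq0 hF)).
have n9 : 9 != 0 :> F by rewrite -(rmorph_nat (in_alg F)) fmorph_eq0.
apply: (mulfI n9); rewrite !(fourier9 z9 zgen).
by apply: eq_bigr => j _; rewrite !trace_vecE // e.
Qed.

(** The form [x . x] takes values in the real subfield, so each [sigma l] can be computed
    through an extension [s_ l] to the whole field, where it gives [2 |s_l x|^2].
    Conversely each automorphism [s] agrees on the real subfield with some
    [sigma l], whence [|s x| = |s_l x|]: the three places control all absolute values of [x]. *)
Lemma place_norms : exists s_ : 'I_3 -> gal_of {:F},
  (forall l x, iota (sigma l (x * barM x + barM x * x)) =
               (2 * cmod (iota (s_ l x)) ^+ 2)%:C) /\
  (forall (s : gal_of {:F}) x, exists l,
      cmod (iota (s x)) ^+ 2 = cmod (iota (s_ l x)) ^+ 2).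
Proof.
have [/fin_all_exists[s_ hs] hl] := Kfield_galois_data hF hsigma.
have inK x : x * barM x + barM x * x \in Kfield zeta.
  have -> : barM x * x = barM (x * barM x).
    apply: (fmorph_inj iota); rewrite !(rmorphM barM) !(rmorphM iota).
    by rewrite !barME !(iota_bar hF) conjcK.
  exact: trace_Kfield.
have two (s : gal_of {:F}) x : iota (s (x * barM x + barM x * x)) =
    (2 * cmod (iota (s x)) ^+ 2)%:C.
  rewrite [barM x * x]mulrC (rmorphD s) (rmorphD iota) iota_gal_norm.
  by rewrite -rmorphD /=; congr _%:C; ring.
exists s_; split=> [l x|s x]; first by rewrite hs ?inK // two.
have [l el] := hl s; exists l.
have := two s x; rewrite -el ?inK // hs ?inK // two => /complexI.
have n2 : 2 != 0 :> R by rewrite pnatr_eq0.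
by move/(mulfI n2) => ->.
Qed.

Variable z : 'I_3 -> R[i].
Hypothesis hz : forall l, 0 < complex.Im (z l).

Definition theta_term n (v : 'rV[F]_n) : R[i] :=
  cexp ((pi : R)%:C * 'i * TrKQ iota sigma z v).

Definition entry_term (x : F) : R[i] := theta_term (const_mx x : 'rV_1).

(** The form [v . v] is the sum of its values on the entries, and [cexp] turns sums into
    products. *)
Lemma theta_term_prod n (v : 'rV[F]_n) :
  theta_term v = \prod_i entry_term (v 0 i).
Proof.
rewrite /entry_term /theta_term -cexp_sum -mulr_sumr; congr (cexp (_ * _)).
rewrite /TrKQ exchange_big /=; apply: eq_bigr => l _.
rewrite -mulr_sumr; congr (_ * _).
rewrite {1}/dot (rmorph_sum (sigma l)) (rmorph_sum iota); apply: eq_bigr => i _.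
by rewrite /dot big_ord1 !mxE.
Qed.

(** Let [Q x] be the sum of the [|s_l x|^2]. The modulus of the term is
    [exp (- 2 pi sum_l Im (z l) |s_l x|^2)], at most [exp (- 2 pi m Q x)] with [m] the least
    imaginary part. Bounding [u v] by [u^2 + v^2] in each conjugate, the integer
    [Tr(x b)] is at most [N Q x + B] with [N] the order of the Galois group
    and [B] depending on [b]. So [Q x] grows at least linearly in the nine integers. *)
Lemma entry_term_decay : exists a q : R, [/\ 0 <= a, 0 <= q < 1 &
  forall x, Lambda_dual iota zeta x ->
    cmod (entry_term x) <= a * \prod_j q ^+ `|trace_vec x 0%R j|%N].
Proof.
have [s_ [hs1 hs2]] := place_norms.
pose Q x : R := \sum_l cmod (iota (s_ l x)) ^+ 2.
have Qge (s : gal_of {:F}) x : cmod (iota (s x)) ^+ 2 <= Q x.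
  have [l ->] := hs2 s x; rewrite /Q (bigD1 l) //= lerDl sumr_ge0 // => k _.
  exact: sqr_ge0.
pose b (j : 'I_9) : F := lam * zeta ^- j.
pose G := 'Gal({:F} / 1)%g.
pose N : R := \sum_(s in G) 1.
pose B j : R := \sum_(s in G) cmod (iota (s (b j))) ^+ 2.
have N0 : 0 < N.
  rewrite /N (bigD1 1%g) ?group1 //= ltr_pwDl ?ltr01 //.
  by rewrite sumr_ge0.
have tle x j : Lambda_dual iota zeta x -> (`|trace_vec x 0%R j|%N)%:R <= N * Q x + B j.
  move=> hx; rewrite -cmod_int -[_%:~R](rmorph_int iota) -trace_vecE //.
  rewrite /TrFQ /galTrace (rmorph_sum iota) (le_trans (cmod_sum _ _ _)) //.
  rewrite /N mulr_suml -big_split /=; apply: ler_sum => s _.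
  rewrite mul1r -mulrA (rmorphM s) (rmorphM iota) cmodM -/(b j).
  have := Qge s x; have := cmod_ge0 (iota (s x)); have := cmod_ge0 (iota (s (b j))).
  nra.
have [m m0 hm] : exists2 m : R, 0 < m & forall l, m <= complex.Im (z l).
  pose y l := complex.Im (z l).
  exists (Num.min (y ord0) (Num.min (y (inord 1)) (y (inord 2)))).
    by rewrite !lt_min !hz.
  move=> l; rewrite !ge_min.
  case: l => [[|[|[|l]]]] hl //.
  - by rewrite (_ : Ordinal hl = ord0) ?lexx //; apply: val_inj.
  - by rewrite (_ : Ordinal hl = inord 1) ?lexx ?orbT //; apply: val_inj; rewrite /= inordK.
  - by rewrite (_ : Ordinal hl = inord 2) ?lexx ?orbT //; apply: val_inj; rewrite /= inordK.
have gle x : cmod (entry_term x) <= expR (- (pi * 2 * m * Q x)).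
  rewrite cmod_cexp ler_expR.
  have -> : TrKQ iota sigma z (const_mx x : 'rV_1) =
      \sum_l z l * (2 * cmod (iota (s_ l x)) ^+ 2)%:C.
    by apply: eq_bigr => l _; rewrite /dot big_ord1 !mxE -hs1.
  have -> : complex.Re ((pi : R)%:C * 'i * \sum_l z l * (2 * cmod (iota (s_ l x)) ^+ 2)%:C) =
      - (pi * \sum_l complex.Im (z l) * (2 * cmod (iota (s_ l x)) ^+ 2)).
    have -> (w : R[i]) : complex.Re ((pi : R)%:C * 'i * w) = - (pi * complex.Im w).
      by case: w => c d /=; ring.
    rewrite (raddf_sum (@complex.Im R)); congr (- (_ * _)); apply: eq_bigr => l _.
    by case: (z l) => c d /=; ring.
  rewrite lerN2 -!mulrA ler_wpM2l ?pi_ge0 // /Q !mulr_sumr; apply: ler_sum => l _.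
  have := hm l; have := sqr_ge0 (cmod (iota (s_ l x))); nra.
(* Summing the nine bounds [tle] gives slope [9 N]. *)
pose K : R := 9 * N; pose d : R := pi * 2 * m / K.
have K0 : 0 < K by rewrite mulr_gt0.
have d0 : 0 < d by rewrite divr_gt0 // !mulr_gt0 // pi_gt0.
exists (expR (d * \sum_j B j)), (expR (- d)); split; first exact: expR_ge0.
  by rewrite expR_ge0 /= expR_lt1 oppr_lt0.
move=> x hx; apply: le_trans (gle x) _.
have -> : \prod_j expR (- d) ^+ `|trace_vec x 0%R j|%N =
    expR (\sum_j (`|trace_vec x 0%R j|%N)%:R * - d).
  by rewrite expR_sum; apply: eq_bigr => j _; rewrite expRM_natl.
rewrite -expRD ler_expR -mulr_suml mulrN -mulNr.
have : \sum_j (`|trace_vec x 0%R j|%N)%:R <= K * Q x + \sum_j B j.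
  apply: le_trans (ler_sum _ (fun j _ => tle x j hx)) _.
  by rewrite big_split /= sumr_const card_ord -mulr_natl mulrA.
have -> : pi * 2 * m * Q x = d * (K * Q x).
  by rewrite /d mulrA divfK ?gt_eqF.
set S := \sum_j _; set T := \sum_j _; nra.
Qed.

End Decay.

(** * Theta series of cosets and codes *)

Section CosetTheta.
Local Open Scope classical_set_scope.
Variables (R : realType) (F : splittingFieldType rat).
Variables (iota : {rmorphism F -> R[i]}) (zeta : F).
Hypothesis hF : is_Q_zeta9 iota zeta.
Variable sigma : 'I_3 -> gal_of (Kfield zeta).
Variable z : 'I_3 -> R[i].
Notation g := (entry_term iota sigma z).
Notation dual := (Lambda_dual iota zeta).

Definition fiber_sum (a : 'Z_3) : R[i] := csum [set x | dual x /\ rho_entry zeta x = a] g.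

(** The coset of [x_a] is the fibre of residue [a], with row vectors of length 1
    identified with scalars. *)
Lemma theta_fiber (a : 'I_3) : theta iota sigma a z = fiber_sum (a : nat)%:R.
Proof.
rewrite /theta /theta_sum (csum_reindex _ _ (phi := fun x : F => const_mx x : 'rV_1)
  (psi := fun v => v 0 0)).
- congr csum; apply/seteqP; split=> x /=.
    by move=> [y hy /matrixP/(_ 0 0)]; rewrite !mxE => e; apply/(coset_LambdaP hF); exists y.
  by move=> /(coset_LambdaP hF)[y hy <-]; exists y.
- by move=> x; rewrite mxE.
- by move=> v; apply/rowP => i; rewrite mxE ord1.
Qed.

(** The symmetry [x -> -x] preserves [x . x] and negates the residue. *)
Lemma fiber_sumN (a : 'Z_3) : fiber_sum (- a) = fiber_sum a.
Proof.
rewrite /fiber_sum (csum_reindex _ _ (phi := -%R) (psi := -%R)); try exact: opprK.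
have dN b x : dual x /\ rho_entry zeta x = b -> dual (- x) /\ rho_entry zeta (- x) = - b.
  move=> [/(dualP hF)[p ->]]; rewrite -mulrN -evN !(rho_entry_ev hF) hornerN intrN => ->.
  by split=> //; apply/(dualP hF); exists (- p).
congr csum.
  apply/seteqP; split=> x /= /dN; last by [].
  by rewrite !opprK.
apply/funext => x; rewrite /entry_term /theta_term /TrKQ /=.
congr (cexp (_ * _)); apply: eq_bigr => l _; congr (_ * iota (sigma l _)).
rewrite /dot !big_ord1 !mxE -!(barME hF) !rmorphN /=; ring.
Qed.

(** In [Z/3] a nonzero entry is 1 or [2 = -1], and these have the same fibre sum. *)
Lemma prod_fiber n (c : 'rV['Z_3]_n) :
  \prod_i fiber_sum (c 0 i) = fiber_sum 0 ^+ l0 c * fiber_sum 1 ^+ l1 c.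
Proof.
rewrite (bigID (fun i => c 0 i == 0)) /= /l0 /l1 -!prodr_const; congr (_ * _).
  by apply: eq_big => i; rewrite ?inE // => /eqP ->.
have E (a : 'Z_3) : (a != 0) = (a == 1) || (a == 2) by case: a => [[|[|[|]]]].
apply: eq_big => i; rewrite ?inE E // => /orP[/eqP -> //|/eqP ->].
by rewrite -fiber_sumN; congr fiber_sum; apply/eqP.
Qed.

End CosetTheta.

Theorem theorem4p9 (R : realType)
    (F : splittingFieldType rat) (iota : {rmorphism F -> R[i]}) (zeta : F)
    (hF : is_Q_zeta9 iota zeta)
    (sigma : 'I_3 -> gal_of (Kfield zeta)) (hsigma : enumerates_Gal sigma)
    (n : nat) (hn : (1 <= n)%N)
    (C : {set 'rV['Z_3]_n}) (hC : is_code C) (hCdual : C \subset dual_code C)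
    (z : 'I_3 -> R[i]) (hz : forall l, 0 < complex.Im (z l)) :
  theta_code iota sigma C z =
    weight_enum C (theta iota sigma (inord 0) z) (theta iota sigma (inord 1) z).
Proof.
have [a [q [a0 q01 hq]]] := entry_term_decay hF hsigma hz.
have bound := sum_patch_le a0 q01 (@trace_vec_inj _ _ _ _ hF) hq.
rewrite /theta_code /theta_sum.
rewrite (_ : (fun v => _) = fun v : 'rV[F]_n => \prod_i entry_term iota sigma z (v 0 i)); last first.
  by apply/funext => v; exact: (theta_term_prod iota sigma z v).
rewrite (csum_code (rho_entry zeta) C bound) /weight_enum.
rewrite !(theta_fiber hF) !inordK //.
by apply: eq_bigr => c _; exact: (prod_fiber hF).
Qed.
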